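(* Let $\widetilde X=(X,X^-)$ be an oriented $N$-dimensional rectangle of a metric space $Z$, with defining homeomorphism $h:I^N\to X$, and let $\psi:Z\supseteq D_\psi\to Z$ be a map. Let $\mathcal D\subseteq X\cap D_\psi$ and suppose there exist $m\ge 2$ nonempty and pairwise disjoint compact sets $\mathcal K_0,\mathcal K_1,\dots,\mathcal K_{m-1}\subseteq\mathcal D$ such that, for $i=0,\dots,m-1$, $(\mathcal D,\mathcal K_i,\psi)$ stretches $\widetilde X$ to $\widetilde X$ along the paths. Then: $(b_1)$ The map $\psi$ induces chaotic dynamics on $m$ symbols in the set $\mathcal D$ relatively to $(\mathcal K_0,\dots,\mathcal K_{m-1})$. $(b_2)$ For each sequence of $m$ symbols $\mathbf s=(s_n)_n\in\{0,1,\dots,m-1\}^{\mathbb N}$, there exists a compact connected set $\mathcal C_{\mathbf s}\subseteq\mathcal K_{s_0}$ which cuts the arcs between $X_\ell$ and $X_r$ in $X$ and such that, for every $w\in\mathcal C_{\mathbf s}$, there is a sequence $(y_n)_n$ with $y_0=w$ and $y_n\in\mathcal K_{s_n}$, $\psi(y_n)=y_{n+1}$ for all $n\ge 0$. The dimension of $\mathcal C_{\mathbf s}$ at each point is at least $N-1$. Moreover, $\dim(\mathcal C_{\mathbf s}\cap\vartheta X)\ge N-2$ and $$\pi:h^{-1}(\mathcal C_{\mathbf s})\cap\partial I^N\to\mathbb R^{N-1}\setminus\{0\}$$ is essential, where $\pi(x)=(x_1-\tfrac12,\dots,x_{N-1}-\tfrac12)$.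
   Context: $I^N=[0,1]^N$ with boundary $\partial I^N$; $\mathbb N=\{0,1,2,\dots\}$. An oriented $N$-dimensional rectangle of a metric space $Z$ is a pair $\widetilde X=(X,X^-)$ where $X=h(I^N)\subseteq Z$ for a homeomorphism $h$ of $I^N$ onto its image $X$, and $X^-=X_\ell\cup X_r$ with $X_\ell=h(\{x\in I^N:x_N=0\})$, $X_r=h(\{x\in I^N:x_N=1\})$. Its contour is $\vartheta X=h(\partial I^N)$. A path is a continuous map $\gamma$ from a compact interval; $\overline\gamma$ is its range; a sub-path of $\gamma$ is its restriction to a closed subinterval of its domain. Stretching along the paths: let $\widetilde X,\widetilde Y$ be oriented $N$-dimensional rectangles of $Z$, $\psi:Z\supseteq D_\psi\to Z$ a map (not necessarily continuous on $D_\psi$), $\mathcal D\subseteq X\cap D_\psi$ and $\mathcal K\subseteq\mathcal D$ compact. We say that $(\mathcal D,\mathcal K,\psi)$ stretches $\widetilde X$ to $\widetilde Y$ along the paths if $\psi$ is continuous on $\mathcal K$ and for every path $\gamma$ with $\overline\gamma\subseteq X$, $\overline\gamma\cap X_\ell\neq\emptyset$, $\overline\gamma\cap X_r\neq\emptyset$, there is a sub-path $\sigma$ of $\gamma$ with $\overline\sigma\subseteq\mathcal K$, $\psi(\overline\sigma)\subseteq Y$, $\psi(\overline\sigma)\cap Y_\ell\neq\emptyset$ and $\psi(\overline\sigma)\cap Y_r\neq\emptyset$. Chaotic dynamics: for $m\ge2$, a map $\psi:Z\supseteq D_\psi\to Z$ and $\mathcal D\subseteq D_\psi$, we say that $\psi$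 induces chaotic dynamics on $m$ symbols in $\mathcal D$ relatively to $(\mathcal K_0,\dots,\mathcal K_{m-1})$, where the $\mathcal K_j\subseteq\mathcal D$ are nonempty pairwise disjoint compact sets, if for each $(s_i)_{i\in\mathbb Z}\in\{0,\dots,m-1\}^{\mathbb Z}$ there exists $(w_i)_{i\in\mathbb Z}\in\mathcal D^{\mathbb Z}$ such that $w_i\in\mathcal K_{s_i}$ and $w_{i+1}=\psi(w_i)$ for all $i\in\mathbb Z$; and, whenever $(s_i)_{i\in\mathbb Z}$ is $k$-periodic ($s_{i+k}=s_i$ for all $i$) for some $k\ge1$, there exists a $k$-periodic sequence $(w_i)_{i\in\mathbb Z}\in\mathcal D^{\mathbb Z}$ with the same property. Given closed nonempty sets $A,B,C\subseteq X$ with $A\cap B=\emptyset$, $C$ cuts the arcs between $A$ and $B$ in $X$ if every continuous path in $X$ whose range meets both $A$ and $B$ has range meeting $C$. $\dim$ is the covering dimension of a metric space. A metric space $\mathcal C$ has dimension at least $j$ at $z_0\in\mathcal C$ if each neighborhood of $z_0$ in $\mathcal C$ has dimension at least $j$. A continuous map is inessential if it is homotopic to a constant map, and essential otherwise.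
   Formalization: The map π is restricted to those points of h^{-1}(C_s)∩∂I^N where π(x)≠0, since C_s may be forced to contain the centre of the face x_N=0 or x_N=1, where π vanishes; essentiality is claimed for this restriction. *)

(* Defs.v *)
From HB Require Import structures.
From mathcomp Require Import all_boot all_order all_algebra.
From mathcomp Require Import all_classical all_reals all_analysis.

Set Implicit Arguments.
Unset Strict Implicit.
Unset Printing Implicit Defensive.

Import Order.TTheory GRing.Theory Num.Theory.
Import numFieldNormedType.Exports.
Local Open Scope classical_set_scope.
Local Open Scope ring_scope.

(* [frontier A] is the topological boundary of [A]. *)
Definition frontier (T : topologicalType) (A : set T) : set T :=
  closure A `\` interior A.

Definition homeo_onto_image (T U : topologicalType) (A : set T) (f : T -> U) :=
  {within A, continuous f} /\
  exists2 g : U -> T,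
    {within f @` A, continuous g} & forall x, A x -> g (f x) = x.

Definition cube (R : realType) (N : nat) : set 'rV[R]_N :=
  [set x | forall i, 0 <= x ord0 i <= 1].
Arguments cube : clear implicits.

(* The ambient dimension is N = n.+1, so that the distinguished last coordinate
   x_N is [x ord0 ord_max]. *)
Record oriented_rectangle (R : realType) (n : nat) (Z : metricType R) :=
  OrientedRectangle {
    rect_homeo : 'rV[R]_n.+1 -> Z ;
    rect_homeoP : homeo_onto_image (cube R n.+1) rect_homeo
  }.

Section rectangle_parts.
Context (R : realType) (n : nat) (Z : metricType R).
Variable X : oriented_rectangle n Z.

Definition rect_carrier : set Z := rect_homeo X @` cube R n.+1.

Definition rect_left : set Z :=
  rect_homeo X @` [set x | cube R n.+1 x /\ x ord0 ord_max = 0].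

Definition rect_right : set Z :=
  rect_homeo X @` [set x | cube R n.+1 x /\ x ord0 ord_max = 1].

Definition rect_contour : set Z := rect_homeo X @` frontier (cube R n.+1).

Definition rect_preimage (C : set Z) : set 'rV[R]_n.+1 :=
  cube R n.+1 `&` rect_homeo X @^-1` C.

End rectangle_parts.

(* A path is a continuous map on a compact interval [a, b]; only the values of
   [g] on the interval matter. Its range is [path_range g a b], and its
   sub-paths are the restrictions of [g] to [c, d] with a <= c <= d <= b. *)
Definition is_path (R : realType) (T : topologicalType) (g : R -> T)
    (a b : R) :=
  a <= b /\ {within `[a, b], continuous g}.

Definition path_range (R : realType) (T : Type) (g : R -> T) (a b : R) :
  set T := g @` `[a, b].

Section dynamics.
Context (R : realType) (n : nat) (Z : metricType R).
Implicit Types (X Y : oriented_rectangle n Z) (D K : set Z).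

(* A partial map Z ⊇ Dpsi -> Z is represented by its domain [Dpsi] and a total
   function [psi] whose values outside [Dpsi] are irrelevant. *)
Variables (Dpsi : set Z) (psi : Z -> Z).

Definition stretches_along_paths D K X Y :=
  [/\ D `<=` rect_carrier X `&` Dpsi, K `<=` D, compact K,
      {within K, continuous psi} &
      forall (g : R -> Z) (a b : R), is_path g a b ->
        path_range g a b `<=` rect_carrier X ->
        path_range g a b `&` rect_left X !=set0 ->
        path_range g a b `&` rect_right X !=set0 ->
        exists c d : R,
          [/\ a <= c, c <= d & d <= b] /\
          [/\ path_range g c d `<=` K,
              psi @` path_range g c d `<=` rect_carrier Y,
              psi @` path_range g c d `&` rect_left Y !=set0 &
              psi @` path_range g c d `&` rect_right Y !=set0]].

Definition follows (m : nat) D (K : 'I_m -> set Z)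
    (s : int -> 'I_m) (w : int -> Z) :=
  forall i : int, [/\ D (w i), K (s i) (w i) & w (i + 1) = psi (w i)].

Definition periodic (T : Type) (k : nat) (u : int -> T) :=
  forall i : int, u (i + k%:Z) = u i.

Definition induces_chaotic_dynamics (m : nat) D (K : 'I_m -> set Z) :=
  [/\ (2 <= m)%N /\ D `<=` Dpsi,
      forall j, [/\ K j `<=` D, K j !=set0 & compact (K j)],
      trivIset setT K,
      forall s : int -> 'I_m, exists w : int -> Z, follows D K s w &
      forall (s : int -> 'I_m) (k : nat), (1 <= k)%N -> periodic k s ->
        exists2 w : int -> Z, periodic k w & follows D K s w].

End dynamics.

Definition cuts_arcs (R : realType) (T : topologicalType) (X A B C : set T) :=
  [/\ [/\ A `<=` X, B `<=` X & C `<=` X],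
      [/\ closed A, closed B & closed C],
      [/\ A !=set0, B !=set0 & C !=set0],
      A `&` B = set0 &
      forall (g : R -> T) (a b : R), is_path g a b ->
        path_range g a b `<=` X ->
        path_range g a b `&` A !=set0 -> path_range g a b `&` B !=set0 ->
        path_range g a b `&` C !=set0].
Arguments cuts_arcs : clear implicits.
Arguments cuts_arcs R {T} X A B C.

(* [covering_dim_lt T k] is dim T <= k - 1: every finite open cover of T has a
   finite open refinement covering T no point of which lies in more than k
   members. For k = 0 it says that T is empty, i.e. dim T = -1. *)
Definition covering_dim_lt (T : topologicalType) (k : nat) :=
  forall (p : nat) (U : 'I_p -> set T),
    (forall i, open (U i)) -> \bigcup_i U i = setT ->
    exists (q : nat) (V : 'I_q -> set T),
      [/\ forall j, open (V j), \bigcup_j V j = setT,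
          forall j, exists i, V j `<=` U i &
          forall x, (#|[pred j | `[< V j x >]]| <= k)%N].

(* j <= dim A for the subspace A; the bound j is an integer so that the value
   -1, attained by the empty set, is covered. *)
Definition dim_ge (T : topologicalType) (A : set T) (j : int) :=
  forall k : nat, covering_dim_lt (set_type A) k -> j < k%:Z.

(* The neighbourhoods of z in the subspace C are the traces on C of its
   neighbourhoods in the ambient space. *)
Definition dim_at_ge (T : topologicalType) (C : set T) (z : T) (j : int) :=
  forall U : set T, nbhs z U -> dim_ge (C `&` U) j.

Definition inessential (R : realType) (T U : topologicalType)
    (A : set T) (B : set U) (f : T -> U) :=
  exists2 c : U, B c & exists H : T * R -> U,
    [/\ {within A `*` `[0, 1], continuous H},
        H @` (A `*` `[0, 1]) `<=` B,
        forall x, A x -> H (x, 0) = f x &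
        forall x, A x -> H (x, 1) = c].
Arguments inessential : clear implicits.
Arguments inessential R {T U} A B f.

(* [f] restricts to an essential continuous map from A to B. *)
Definition essential (R : realType) (T U : topologicalType)
    (A : set T) (B : set U) (f : T -> U) :=
  [/\ {within A, continuous f}, f @` A `<=` B & ~ inessential R A B f].
Arguments essential : clear implicits.
Arguments essential R {T U} A B f.

Definition centred_proj (R : realType) (n : nat) (x : 'rV[R]_n.+1) : 'rV[R]_n :=
  \row_(i < n) (x ord0 (widen_ord (leqnSn n) i) - 2^-1).

(* [centred_proj] vanishes at the centres of the faces x_N = 0 and x_N = 1 of
   the cube, and a cutting set may contain them: for N = 2, h the identity,
   psi (x, y) = (x / 2, 3 y) on [0, 1] x [0, 1/3],
   psi (x, y) = (x / 2, 3 y - 2) on [0, 1] x [2/3, 1] and the itinerary 000...,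
   the only possible one is the edge y = 0. So the map A -> R^(N-1) \ {0} is
   read as a partial map, with domain the set of points of A sent into
   R^(N-1) \ {0}; this is A itself as soon as [centred_proj] has no zero
   on A. *)
Definition centred_proj_domain (R : realType) (n : nat)
    (A : set 'rV[R]_n.+1) : set 'rV[R]_n.+1 :=
  A `&` @centred_proj R n @^-1` (~` [set 0]).

(* Main.v *)
Require Import Defs.
From HB Require Import structures.
From mathcomp Require Import all_boot all_order all_algebra.
From mathcomp Require Import all_classical all_reals all_analysis.
From mathcomp Require Import ring lra zify.

Set Implicit Arguments.
Unset Strict Implicit.
Unset Printing Implicit Defensive.

Import Order.TTheory GRing.Theory Num.Theory.
Import numFieldNormedType.Exports.
Local Open Scope classical_set_scope.
Local Open Scope ring_scope.

(* Everything is transported to the cube by [h]. The basic tool is the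
   Poincaré–Miranda theorem, obtained combinatorially: for 0/1 functions on the
   vertices of a grid which are 0 on the faces x_i = 0 and 1 on the faces
   x_i = 1, the cup product of their coboundaries modulo 2 sums to 1 over the
   grid, so that some cell sees all of them change.

   A closed set cuts the arcs between bottom and top iff it contains the zeros
   of a continuous function which is nonpositive on the bottom and nonnegative
   on the top. For a stretching map f, the set where f(x)_N = x_N cuts, and
   Poincaré–Miranda on it gives a fixed point of f; stretching maps compose, so
   this yields periodic itineraries, and Tychonoff's theorem the bi-infinite
   ones. The points following a given forward itinerary form a decreasing
   intersection of closed cutting sets, hence a closed cutting set; C_s is a
   minimal closed cutting subset of it. Its connectedness is Poincaré–Miranda on
   a square, and the lower bounds on dimensions and the essential map are
   Poincaré–Miranda on C_s: a cover of low order, or a null-homotopy, would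
   give nowhere vanishing maps with the boundary signs of the centred
   projection. *)

(** * Coboundaries on a grid *)

(** The map [psi] is continuous only on the sets [K i], so the functions to be annihilated live on
    closed subsets of the cube. The grid argument therefore labels vertices by arbitrary predicates,
    and continuity enters only at a limit point of the cells. This yields one zero theorem: [n]
    functions on a separator, with opposite signs on opposite lateral faces, vanish together at a
    zero of [Phi]. Trading a cut for a function [Phi] turns a condition on paths into the sign
    condition for the last coordinate.

    Minimality serves only connectedness and the dimension at each point; the bound on the contour
    and the essential map hold for every closed cut. These two use only the lateral faces of the
    contour: there some component of the centred projection is 1/2 or -1/2, whereas the bottom and
    top contain its zeros. For the dimension, a cover of order at most [k] is condensed into [n.+1]
    masses, no more than [k] of them positive at once, and the functions are chosen so that a common
    zero makes masses positive. *)

Section grid.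
Context (I : eqType).
Implicit Types (i j l : I) (z : I -> nat) (g : (I -> nat) -> 'F_2) (J A : seq I).

Definition upd z j t : I -> nat := fun i => if i == j then t else z i.

Definition shift j z := upd z j (z j).+1.

(** Modulo 2 the sum is the difference, so no orientation signs are needed. *)
Definition gdiff j g z : 'F_2 := g (shift j z) + g z.

Lemma addF2 (x : 'F_2) : x + x = 0.
Proof. by apply/val_inj; case: x => -[|[|]]. Qed.

Lemma shiftC i j z : shift i (shift j z) = shift j (shift i z).
Proof.
apply/funext => l; rewrite /shift /upd.
by have [->|ij] := eqVneq i j => //; do ! case: eqP => //; congruence.
Qed.

Lemma gdiffC i j g z : gdiff i (gdiff j g) z = gdiff j (gdiff i g) z.
Proof. by rewrite /gdiff shiftC; ring. Qed.

(** Exchanging [i] and [j] pairs off the terms, and equal terms cancel modulo 2. *)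
Lemma sum_offdiag J (f : I -> I -> 'F_2) : (forall i j, f i j = f j i) ->
  \sum_(j <- J) \sum_(i <- [seq i <- J | i != j]) f i j = 0.
Proof.
move=> fC; pose h i j := if i != j then f i j else 0.
rewrite (eq_bigr (fun j => \sum_(i <- J) h i j)); last first.
  by move=> j _; rewrite big_filter big_mkcond.
have hC i j : h i j = h j i by rewrite /h eq_sym fC.
elim: J => [|x J IH]; first by rewrite big_nil.
rewrite big_cons big_cons {1}/h eqxx add0r.
under [X in _ + X]eq_bigr do rewrite big_cons.
rewrite big_split /= IH addr0.
by under eq_bigr do rewrite hC; rewrite addF2.
Qed.

Variable a : I -> (I -> nat) -> 'F_2.

(* The cup product of the coboundaries of [a i], [i] in [A], evaluated on the
   cubical cell at [z] with set of directions [J], modulo 2. *)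
Fixpoint cup J A z : 'F_2 :=
  if A is i :: A' then
    \sum_(j <- J) gdiff j (a i) z * cup [seq l <- J | l != j] A' (shift j z)
  else 1.

Lemma filterC (p q : pred I) J :
  [seq i <- [seq i <- J | p i] | q i] = [seq i <- [seq i <- J | q i] | p i].
Proof. by rewrite -!filter_predI; apply: eq_filter => i /=; rewrite andbC. Qed.

(** A cup product of coboundaries is a cocycle: this is the Leibniz rule together with the vanishing
    of the double coboundary. *)
Lemma coboundary_cup A J z :
  \sum_(j <- J) gdiff j (cup [seq l <- J | l != j] A) z = 0.
Proof.
elim: A J z => [|i A IH] J z /=.
  by apply: big1 => j _; rewrite /gdiff /= addF2.
pose B j l := [seq k <- [seq k <- J | k != j] | k != l].
have BC j l : B j l = B l j by exact: filterC.
(* Leibniz rule for [gdiff j]. The first summand is symmetric in [j] and [l], so its sum vanishes;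
   grouped by [l], the second is the induction hypothesis at [shift l z]. *)
rewrite (eq_bigr (fun j => \sum_(l <- [seq l <- J | l != j])
   (gdiff j (gdiff l (a i)) z * cup (B j l) A (shift j (shift l z)) +
    gdiff l (a i) z * gdiff j (cup (B j l) A) (shift l z)))); last first.
  move=> j _; rewrite /gdiff -big_split /=; apply: eq_bigr => l _.
  rewrite -/(B j l) (shiftC l j) -[LHS]addr0.
  by rewrite -(addF2 ((a i (shift l z) + a i z) * cup (B j l) A (shift j (shift l z)))); ring.
under eq_bigr do rewrite big_split.
rewrite big_split /= sum_offdiag ?add0r; last first.
  by move=> j l; rewrite gdiffC shiftC BC.
under eq_bigr do rewrite big_filter.
rewrite (exchange_big_dep predT) //=; apply: big1 => l _.
rewrite -mulr_sumr; under eq_bigl do rewrite eq_sym.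
rewrite -big_filter (eq_bigr (fun j => gdiff j
  (cup [seq k <- [seq k <- J | k != l] | k != j] A) (shift l z))).
  by rewrite IH mulr0.
by move=> j _; rewrite BC.
Qed.

Fixpoint box k J g z : 'F_2 :=
  if J is j :: J' then \sum_(t < k) box k J' g (upd z j t) else g z.

Lemma eq_box k J g1 g2 z : g1 =1 g2 -> box k J g1 z = box k J g2 z.
Proof.
by move=> e; elim: J z => //= j J IH z; apply: eq_bigr => t _; rewrite IH.
Qed.

Lemma box_sum k J (T : Type) (r : seq T) (g : T -> (I -> nat) -> 'F_2) z :
  box k J (fun y => \sum_(t <- r) g t y) z = \sum_(t <- r) box k J (g t) z.
Proof.
elim: J z => //= j J IH z; rewrite exchange_big; apply: eq_bigr => t _.
by rewrite IH.
Qed.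

Lemma boxD k J g1 g2 z :
  box k J (fun y => g1 y + g2 y) z = box k J g1 z + box k J g2 z.
Proof.
elim: J z => //= j J IH z; rewrite -big_split; apply: eq_bigr => t _.
by rewrite IH.
Qed.

Lemma upd_shift z j t : upd z j t.+1 = shift j (upd z j t).
Proof. by apply/funext => l; rewrite /shift /upd eqxx; case: eqP. Qed.

Lemma shift_upd z i j t : i != j -> shift i (upd z j t) = upd (shift i z) j t.
Proof.
move=> ij; apply/funext => l; rewrite /shift /upd (negbTE ij).
by do ! case: eqP => //; move/eqP: ij; congruence.
Qed.

Lemma box_gdiff k J g z j : j \notin J ->
  box k J (gdiff j g) z = gdiff j (box k J g) z.
Proof.
elim: J z => //= i J IH z; rewrite inE negb_or => /andP[ji jJ].
rewrite /gdiff -big_split /=; apply: eq_bigr => t _.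
by rewrite (IH _ jJ) /gdiff shift_upd.
Qed.

(** Telescoping: every intermediate layer is counted twice and cancels. *)
Lemma box_gdiff_head k J g z j : j \notin J ->
  box k (j :: J) (gdiff j g) z = box k J g (upd z j k) + box k J g (upd z j 0).
Proof.
move=> jJ /=; under eq_bigr do rewrite (box_gdiff _ _ _ jJ) /gdiff -upd_shift.
pose F t := box k J g (upd z j t); rewrite -[RHS]/(F k + F 0%N).
rewrite -[LHS]/(\sum_(t < k) (F t.+1 + F t)).
elim: k F => [|k' IH] F; first by rewrite big_ord0 addF2.
by rewrite big_ord_recr /= IH -[RHS]addr0 -(addF2 (F k')); ring.
Qed.

Lemma box_eq0 k J j g z : (forall y, y j = z j -> g y = 0) -> j \notin J ->
  box k J g z = 0.
Proof.
elim: J z => /= [|i J IH] z g0; first by move=> _; exact: g0.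
rewrite inE negb_or => /andP[ji jJ].
apply: big1 => t _; apply: IH jJ => y yj; apply: g0.
by rewrite yj /upd (negbTE ji).
Qed.

Lemma box_gdiff_eq0 k J j g z : uniq J -> j \in J ->
  (forall y, y j = 0%N \/ y j = k -> g y = 0) -> box k J (gdiff j g) z = 0.
Proof.
elim: J z => // i J IH z /= /andP[iJ uJ]; rewrite inE.
have [-> _ g0|_ /= jJ g0] := eqVneq j i; last by apply: big1 => t _; exact: IH.
have b0 t : t = 0%N \/ t = k -> box k J g (upd z i t) = 0.
  move=> t0; apply: (@box_eq0 _ _ i) => // y; rewrite /upd eqxx => yi.
  by apply: g0; rewrite yi.
by have := box_gdiff_head k g z iJ; rewrite /= => ->; rewrite !b0 ?addr0; auto.
Qed.

(** Stokes' theorem and induction on the dimension. Since the product over [J] is a cocycle, the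
    whole product is the coboundary of [a j0] times it, and the sum reduces to the boundary of the
    grid. Only the face [y j0 = k] contributes, where [a j0] is 1 and the induction hypothesis
    applies. *)
Lemma box_cup k J z : uniq J ->
  (forall j y, j \in J -> y j = 0%N -> a j y = 0) ->
  (forall j y, j \in J -> y j = k -> a j y = 1) ->
  box k J (cup J J) z = 1.
Proof.
elim: J z => //= j0 J IH z /andP[j0J uJ] a0 a1.
(* On a cell contained in a face [y j = 0] or [y j = k] the function [a j] is constant, so its
   coboundary kills the product. *)
have cup_eq0 A Jd y j : j \notin Jd -> j \in A -> j \in J ->
    y j = 0%N \/ y j = k -> cup Jd A y = 0.
  move=> + + jJ.
  elim: A Jd y => // i A IHA Jd y jJd; rewrite inE => ijA yj /=.
  rewrite big_seq; apply: big1 => l lJd.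
  have lj : j != l by apply: contraNneq jJd => ->.
  have syj : shift l y j = y j by rewrite /shift /upd (negbTE lj).
  have [->|ij] := eqVneq i j; last first.
    rewrite (IHA _ (shift l y)) ?mulr0 ?syj //; first by rewrite mem_filter (negbTE jJd) andbF.
    by move: ijA; rewrite eq_sym (negbTE ij).
  rewrite /gdiff; suff -> : a j (shift l y) = a j y by rewrite addF2 mul0r.
  have jJ0 : j \in j0 :: J by rewrite inE jJ orbT.
  by case: yj => yj; [rewrite !(a0 j) ?syj | rewrite !(a1 j) ?syj].
(* The primitive: [a j0] times the remaining product, on the faces of the cell orthogonal to [j]. *)
pose g j y := a j0 y * cup [seq l <- j0 :: J | l != j] J y.
have e y : cup (j0 :: J) (j0 :: J) y = \sum_(j <- j0 :: J) gdiff j (g j) y.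
  rewrite [RHS](_ : _ = \sum_(j <- j0 :: J) gdiff j (a j0) y *
     cup [seq l <- j0 :: J | l != j] J (shift j y) + a j0 y *
     \sum_(j <- j0 :: J) gdiff j (cup [seq l <- j0 :: J | l != j] J) y).
    by rewrite coboundary_cup mulr0 addr0.
  rewrite mulr_sumr -big_split /=; apply: eq_bigr => j _.
  rewrite /gdiff /g -[LHS]addr0.
  by rewrite -(addF2 (a j0 y * cup [seq l <- j0 :: J | l != j] J (shift j y))); ring.
have J0 : [seq l <- j0 :: J | l != j0] = J.
  rewrite /= eqxx /=; apply/all_filterP/allP => l lJ.
  by apply: contraNneq j0J => <-.
have -> : \sum_(t < k) box k J (cup (j0 :: J) (j0 :: J)) (upd z j0 t) =
    box k (j0 :: J) (cup (j0 :: J) (j0 :: J)) z by [].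
rewrite (eq_box _ _ _ e) box_sum big_cons big_seq big1 ?addr0; last first.
  move=> j jJ; apply: box_gdiff_eq0; rewrite ?inE ?jJ ?orbT //=; first by rewrite j0J.
  move=> y yj; rewrite /g (cup_eq0 _ _ _ j) ?mulr0 // mem_filter eqxx //.
rewrite box_gdiff_head // [X in _ + X](@box_eq0 _ _ j0) ?addr0 //; last first.
  by move=> y; rewrite /upd eqxx => y0; rewrite /g a0 ?mul0r // mem_head.
rewrite -(IH (upd z j0 k) uJ); last 2 first.
- by move=> j y jJ; apply: a0; rewrite inE jJ orbT.
- by move=> j y jJ; apply: a1; rewrite inE jJ orbT.
apply/eqP; rewrite -subr_eq0; apply/eqP.
have oppF2 (x : 'F_2) : - x = x by apply: (addIr x); rewrite addNr addF2.
rewrite oppF2.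
rewrite -boxD; apply: (@box_eq0 _ _ j0) => // y; rewrite /upd eqxx => yk.
by rewrite /g J0 a1 ?mem_head // mul1r addF2.
Qed.

Lemma box_neq0 k J g z : uniq J -> box k J g z != 0 ->
  exists2 y, g y != 0 & forall i, if i \in J then (y i < k)%N else y i == z i.
Proof.
elim: J z => [|j J IH] z /=; first by move=> _ gz; exists z.
move=> /andP[jJ uJ] b0.
have [t bt] : exists t : 'I_k, box k J g (upd z j t) != 0.
  apply/existsP; apply: contraNT b0 => /existsPn b0.
  by apply/eqP/big1 => t _; apply/eqP; rewrite -[_ == _]negbK b0.
have [y gy yP] := IH _ uJ bt; exists y => // i.
rewrite inE; have := yP i; rewrite /upd; have [->|ij] //= := eqVneq i j.
by rewrite (negbTE jJ) => /eqP ->.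
Qed.

(** A nonzero summand is an edge path through the cell along which the functions change in turn; [p]
    and [q] are the ends of the edge belonging to [i]. *)
Lemma cup_neq0 A J z : cup J A z != 0 -> forall i, i \in A ->
  exists p q, [/\ a i p != a i q, forall l, (z l <= p l <= z l + (l \in J))%N &
                                  forall l, (z l <= q l <= z l + (l \in J))%N].
Proof.
elim: A J z => // i0 A IH J z /= s0 i.
have [j jJ] : exists2 j, j \in J & gdiff j (a i0) z *
    cup [seq l <- J | l != j] A (shift j z) != 0.
  apply/hasP; apply: contraNT s0 => /hasPn s0.
  by rewrite big_seq; apply/eqP/big1 => j jJ; apply/eqP; rewrite -[_ == _]negbK s0.
rewrite mulf_eq0 negb_or => /andP[d0 c0]; rewrite inE => /orP[/eqP ->|iA].
  exists (shift j z), z; split.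
  - by apply: contraNneq d0 => e; rewrite /gdiff e addF2.
  - by move=> l; rewrite /shift /upd; case: eqP => [->|_]; rewrite ?jJ; lia.
  - by move=> l; lia.
have [p [q [apq pP qP]]] := IH _ _ c0 _ iA.
have cellW r : (forall l, (shift j z l <= r l <=
    shift j z l + (l \in [seq l <- J | l != j]))%N) ->
    forall l, (z l <= r l <= z l + (l \in J))%N.
  move=> rP l; have := rP l; rewrite mem_filter /shift /upd.
  by case: eqP => [->|_] /=; rewrite ?jJ; lia.
by exists p, q; split => //; exact: cellW.
Qed.
End grid.

Lemma grid_cell_change (N k : nat) (a : 'I_N -> ('I_N -> nat) -> bool) :
  (forall i y, y i = 0%N -> a i y = false) -> (forall i y, y i = k -> a i y) ->
  exists2 z : 'I_N -> nat, (forall i, z i < k)%N &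
    forall i, exists p q, [/\ a i p = false, a i q,
      forall l, (z l <= p l <= (z l).+1)%N & forall l, (z l <= q l <= (z l).+1)%N].
Proof.
move=> a0 a1; pose b i y : 'F_2 := (a i y)%:R.
have b1 : box k (enum 'I_N) (cup b (enum 'I_N) (enum 'I_N)) (fun=> 0%N) = 1.
  apply: box_cup; first exact: enum_uniq.
    by move=> i y _ yi; rewrite /b a0.
  by move=> i y _ yi; rewrite /b a1.
have [|z z0 zk] := @box_neq0 _ k (enum 'I_N) (cup b (enum 'I_N) (enum 'I_N))
  (fun=> 0%N) (enum_uniq _).
  by rewrite b1 oner_neq0.
exists z => i; first by have := zk i; rewrite mem_enum.
have [|p [q [bpq pP qP]]] := cup_neq0 z0 (i := i); first by rewrite mem_enum.
have cellW r : (forall l, (z l <= r l <= z l + (l \in enum 'I_N))%N) ->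
    forall l, (z l <= r l <= (z l).+1)%N.
  by move=> rP l; have := rP l; rewrite mem_enum inE /=; lia.
move: bpq; rewrite /b; case ap: (a i p); case aq: (a i q); rewrite ?eqxx // => _.
  by exists q, p; split=> //; exact: cellW.
by exists p, q; split=> //; exact: cellW.
Qed.

(** * Poincaré–Miranda on a separator *)

Lemma within_ballP (R : realType) (T U : pseudoMetricType R) (A : set T)
    (f : T -> U) :
  {within A, continuous f} <-> forall x, A x -> forall e : R, 0 < e ->
    exists2 d : R, 0 < d & forall y, A y -> ball x d y -> ball (f x) e (f y).
Proof.
split=> [/subspace_continuousP cf x Ax e e0|cf].
  have /nbhs_ballP[d d0 dP] := cf x Ax _ (nbhsx_ballx (f x) e e0).
  by exists d => // y Ay xy; exact: dP.
apply/subspace_continuousP => x Ax W /nbhs_ballP[e e0 eW].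
have [d d0 dP] := cf x Ax e e0.
by apply/nbhs_ballP; exists d => // y xy Ay; apply/eW/dP.
Qed.

Lemma continuous_preimage_closed (T U : topologicalType) (f : T -> U)
    (B : set U) : continuous f -> closed B -> closed (f @^-1` B).
Proof. by move=> cf; apply: preimage_closed => x _; exact: cf. Qed.

Lemma closed_within_preimage (T U : topologicalType) (A : set T) (B : set U)
    (f : T -> U) :
  closed A -> closed B -> {within A, continuous f} ->
  closed (A `&` f @^-1` B).
Proof.
move=> cA cB /continuous_closedP/(_ _ cB)/closed_subspaceP[V cV].
by rewrite setIC => VA; rewrite [X in closed X]setIC -VA setIC; exact: closedI.
Qed.

Lemma within_comp (T U V : topologicalType) (A : set T) (B : set U)
    (f : T -> U) (g : U -> V) :
  {within A, continuous f} -> {within B, continuous g} -> f @` A `<=` B ->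
  {within A, continuous (g \o f)}.
Proof.
move=> /continuous_closedP cf /continuous_closedP cg AB.
apply/continuous_closedP => W /cg/closed_subspaceP[V1 /cf/closed_subspaceP[V2 cV2 e2] e1].
apply/closed_subspaceP; exists V2 => //; rewrite e2.
apply/seteqP; split=> x [fx Ax]; split=> //=; have Bfx : B (f x) by apply: AB; exists x.
  by have : (V1 `&` B) (f x) by []; rewrite e1 => -[].
by have : (g @^-1` W `&` B) (f x) by []; rewrite -e1 => -[].
Qed.

Lemma rV_continuous (R : realType) (T : topologicalType) (n : nat)
    (f : T -> 'rV[R]_n) :
  (forall i, continuous (fun x => f x ord0 i)) -> continuous f.
Proof.
move=> cf x W /nbhs_ballP[e e0 eW].
have : \forall y \near x, forall i, ball (f x ord0 i) e (f y ord0 i).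
  by apply: filter_forall => i; exact: (cf i x _ (nbhsx_ballx _ e e0)).
apply: filterS => y yP; apply: eW; split=> // i j.
by rewrite (ord1 i).
Qed.

Section cube_topology.
Context {R : realType}.

Lemma ler_coord n (x : 'rV[R]_n) i : `|x ord0 i| <= `|x|.
Proof.
by rewrite [leRHS]/Num.Def.normr /= mx_normrE; exact: (le_bigmax _ _ (ord0, i)).
Qed.

Lemma rV_norm_le n (x : 'rV[R]_n) e : 0 <= e ->
  (forall i, `|x ord0 i| <= e) -> `|x| <= e.
Proof.
move=> e0 xe; rewrite /Num.Def.normr /= mx_normrE; apply/bigmax_leP.
by split=> // -[i j] _; rewrite (ord1 i).
Qed.

Lemma dist_continuous n (z : 'rV[R]_n) : continuous (fun y : 'rV[R]_n => `|y - z| : R).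
Proof.
move=> y; have h : (fun y : 'rV[R]_n => y - z) @ y --> y - z.
  by apply: continuousB; [exact: cvg_id | exact: cst_continuous].
by apply: (continuous_comp h); exact: norm_continuous.
Qed.

Lemma cube_compact n : compact (cube R n).
Proof.
exact: (@rV_compact R n (fun=> `[0, 1]%classic) (fun=> @segment_compact R 0 1)).
Qed.

Lemma cube_closed n : closed (cube R n).
Proof. by apply: compact_closed; [exact: norm_hausdorff | exact: cube_compact]. Qed.

(** The labels are overwritten by 0 and 1 on the faces x_j = 0 and x_j = 1, so [P] may be any
    predicate; the two alternatives in the conclusion account for the overwritten vertices. *)
Lemma cube_grid n k (P : 'I_n -> 'rV[R]_n -> Prop) : exists x, cube R n x /\
  forall j, exists p q, [/\ cube R n p, cube R n q,
    `|p - x| <= k.+1%:R^-1, `|q - x| <= k.+1%:R^-1 &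
    (p ord0 j = 0 \/ ~ P j p) /\ (q ord0 j = 1 \/ P j q)].
Proof.
have k0 : (0 : R) < k.+1%:R by rewrite ltr0n.
pose pt (z : 'I_n -> nat) : 'rV[R]_n := \row_i ((z i)%:R / k.+1%:R).
pose a j z := if z j == 0%N then false else (z j == k.+1) || `[< P j (pt z) >].
have [||z zk zP] := @grid_cell_change n k.+1 a.
- by move=> i y y0; rewrite /a y0 eqxx.
- by move=> i y yk; rewrite /a yk eqxx.
have cubeP y : (forall i, (y i <= k.+1)%N) -> cube R n (pt y).
  move=> yk i; rewrite mxE divr_ge0 //= ler_pdivrMr // mul1r ler_nat; exact: yk.
exists (pt z); split; first by apply: cubeP => i; exact/ltnW/zk.
move=> j; have [p [q [ap aq pz qz]]] := zP j.
have cell y : (forall l, (z l <= y l <= (z l).+1)%N) ->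
    cube R n (pt y) /\ `|pt y - pt z| <= k.+1%:R^-1.
  move=> yz; split.
    by apply: cubeP => i; have /andP[_ h] := yz i; exact: leq_trans h (zk i).
  apply: rV_norm_le => [|i]; first by rewrite invr_ge0 ltW.
  have /andP[h1 h2] := yz i.
  rewrite !mxE -mulrBl -natrB // normrM normr_nat gtr0_norm ?invr_gt0 //.
  by rewrite ler_piMl ?invr_ge0 ?(ltW k0) // (ler_nat _ _ 1); lia.
have [cp dp] := cell _ pz; have [cq dq] := cell _ qz.
exists (pt p), (pt q); split=> //; split.
  move: ap; rewrite /a mxE; case: eqP => [-> _|_]; first by left; rewrite mul0r.
  by move=> /norP[_ /asboolPn]; right.
move: aq; rewrite /a mxE; case: eqP => // _ /orP[/eqP ->|/asboolP]; last by right.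
by left; rewrite divff // gt_eqF.
Qed.

Lemma cube_grid_limit n (P : 'I_n -> 'rV[R]_n -> Prop) : exists x, cube R n x /\
  forall e, 0 < e -> forall j, exists p q, [/\ cube R n p, cube R n q,
    `|p - x| < e, `|q - x| < e &
    (p ord0 j = 0 \/ ~ P j p) /\ (q ord0 j = 1 \/ P j q)].
Proof.
have [u uP] := choice (fun k => cube_grid k P).
have [x [cx clx]] : cube R n `&` cluster (u @ \oo) !=set0.
  by apply: cube_compact; exists 0%N => // k _; have [] := uP k.
exists x; split=> // e e0 j.
have e20 : 0 < e / 2 by rewrite divr_gt0.
have small : \forall k \near \oo, (k.+1%:R^-1 : R) < e / 2.
  exact: near_infty_natSinv_lt (PosNum e20).
have [|y [[k ke <-] xy]] := clx (u @` [set k | (k.+1%:R^-1 : R) < e / 2])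
    (ball x (e / 2)) _ (nbhsx_ballx _ _ e20).
  by apply: filterS small => k ke; exists k.
have [_ /(_ j)[p [q [cp cq dp dq pq]]]] := uP k.
rewrite -ball_normE /= distrC in xy.
exists p, q; split=> //; rewrite -[_ - x](subrKA (u k)) (splitr e);
  by apply: le_lt_trans (ler_normD _ _) _; rewrite ltrD //; apply: le_lt_trans ke.
Qed.

Definition lateral n (i : 'I_n) : 'I_n.+1 := widen_ord (leqnSn n) i.

Lemma lift_ord_max n (i : 'I_n) : lift ord_max i = lateral i.
Proof. by apply/val_inj; rewrite /= /bump leqNgt ltn_ord. Qed.

Lemma nearest_point n (E : set 'rV[R]_n) : closed E -> E `<=` cube R n ->
  E !=set0 -> exists r : 'rV[R]_n -> 'rV[R]_n,
    forall z, E (r z) /\ forall y, E y -> `|r z - z| <= `|y - z|.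
Proof.
move=> cE Ecube E0.
suff /choice[r rP] : forall z : 'rV[R]_n, exists c, E c /\
    forall y, E y -> `|c - z| <= `|y - z| by exists r.
move=> z.
have coE : compact E by apply: subclosed_compact Ecube => //; exact: cube_compact.
have [|c cE' cP] := @compact_EVT_min _ R (fun y : 'rV[R]_n => `|y - z|) E E0 coE.
  exact/continuous_subspaceT/dist_continuous.
by exists c; split=> [|y Ey]; [rewrite inE in cE' | apply: cP; rewrite inE].
Qed.

(** The inequalities are weak so that [E] may touch, or contain, the bottom or the top; the zeros of
    [Phi] may form a proper part of [E]. *)
Definition separating n (E : set 'rV[R]_n.+1) (Phi : 'rV[R]_n.+1 -> R) :=
  [/\ continuous Phi,
      forall x, cube R n.+1 x -> x ord0 ord_max = 0 -> Phi x <= 0,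
      forall x, cube R n.+1 x -> x ord0 ord_max = 1 -> 0 <= Phi x &
      forall x, cube R n.+1 x -> Phi x = 0 -> E x].

(* Off [E], the [F i] are evaluated at a nearest point of [E]: near a point of
   [E] this changes their sign no more than continuity does. *)
Lemma separator_common_zero n (E : set 'rV[R]_n.+1) (Phi : 'rV[R]_n.+1 -> R)
    (F : 'I_n -> 'rV[R]_n.+1 -> R) :
  closed E -> E `<=` cube R n.+1 -> separating E Phi ->
  (forall i, {within E, continuous (F i)}) ->
  (forall i x, E x -> x ord0 (lateral i) = 0 -> F i x <= 0) ->
  (forall i x, E x -> x ord0 (lateral i) = 1 -> 0 <= F i x) ->
  exists x, [/\ E x, Phi x = 0 & forall i, F i x = 0].
Proof.
move=> cE Ecube [cPhi Phi0 Phi1 PhiE] cF F0 F1.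
(* At this stage [E] may still be empty; a point of it comes only with the zero of [Phi] found
   below. *)
have [r rP] : exists r : 'rV[R]_n.+1 -> 'rV[R]_n.+1,
    E !=set0 -> forall z, E (r z) /\ forall y, E y -> `|r z - z| <= `|y - z|.
  have [/(nearest_point cE Ecube)[r rP]|E0] := pselect (E !=set0); first by exists r.
  by exists id.
(* The last direction tests [Phi], the lateral ones test [F i] at the nearest point. *)
pose P j p := if unlift ord_max j is Some i then 0 < F i (r p) else 0 < Phi p.
have [x [cx xP]] := cube_grid_limit P.
have near_Phi e : 0 < e -> exists2 d, 0 < d & forall y, `|y - x| < d ->
    `|Phi x - Phi y| < e.
  move=> e0; have /nbhs_ballP[d d0 dP] := cPhi x _ (nbhsx_ballx _ e e0).
  exists d => // y yx; have := dP y; rewrite -!ball_normE /=; apply.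
  by rewrite distrC.
have Phix : Phi x = 0.
  apply/eqP; rewrite eq_le; apply/andP; split; rewrite leNgt; apply/negP => h.
    have [d d0 dP] := near_Phi _ h.
    have [p [_ [cp _ dp _ [pP _]]]] := xP d d0 ord_max.
    have : 0 < Phi p by have := dP _ dp; rewrite ltr_norml => /andP[_]; lra.
    move: pP; rewrite /P unlift_none => -[/(Phi0 _ cp)|] //.
    by rewrite leNgt => /negP.
  rewrite -oppr_gt0 in h; have [d d0 dP] := near_Phi _ h.
  have [_ [q [_ cq _ dq [_ qP]]]] := xP d d0 ord_max.
  have : Phi q < 0 by have := dP _ dq; rewrite ltr_norml => /andP[]; lra.
  move: qP; rewrite /P unlift_none => -[/(Phi1 _ cq)|] h1; first by rewrite ltNge h1.
  by rewrite ltNge (ltW h1).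
have Ex := PhiE _ cx Phix.
have {}rP : forall z, E (r z) /\ `|r z - z| <= `|x - z|.
  by move=> z; have [|? /(_ _ Ex)] := rP _ z; first by exists x.
exists x; split=> // i.
have near_F e : 0 < e -> exists2 d, 0 < d & forall p, `|p - x| < d ->
    `|F i x - F i (r p)| < e.
  move=> e0; have /within_ballP/(_ _ Ex _ e0)[d d0 dP] := cF i.
  (* As [x] belongs to [E], the nearest point [r p] is within twice the distance from [p] to [x]. *)
  exists (d / 2) => [|p px]; first by rewrite divr_gt0.
  have [Erp rpx] := rP p; have := dP _ Erp; rewrite -!ball_normE /=; apply.
  rewrite distrC -(subrKA p) (splitr d) (le_lt_trans (ler_normD _ _)) // ltrD //.
  by apply: le_lt_trans rpx _; rewrite distrC.
(* If [F i x > 0], then [P] holds at all points close to [x], so the points [p] near [x] lie on the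
   face x_i = 0; hence so does [x], against [F0]. The other sign is symmetric. *)
have coord c y : (forall d, 0 < d -> exists2 p, `|p - x| < d & p ord0 y = c) ->
    x ord0 y = c.
  move=> h; apply/eqP; rewrite -subr_eq0 -normr_le0; apply/ler_addgt0Pr => d d0.
  have [p pd <-] := h d d0; rewrite add0r distrC (le_trans _ (ltW pd)) //.
  by rewrite (le_trans _ (ler_coord _ y)) // !mxE.
apply/eqP; rewrite eq_le; apply/andP; split; rewrite leNgt; apply/negP => h.
  have [d d0 dP] := near_F _ h.
  move: (h); rewrite ltNge => /negP; apply; apply: F0 => //; apply: coord => d' d'0.
  have m0 : 0 < Num.min d d' by rewrite lt_min d0.
  have [p [_ [_ _ + _ [pP _]]]] := xP _ m0 (lateral i).
  rewrite lt_min => /andP[pd pd']; exists p => //; move: pP.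
  rewrite /P -lift_ord_max liftK => -[//|]; case.
  by have := dP _ pd; rewrite ltr_norml => /andP[_]; lra.
rewrite -oppr_gt0 in h; have [d d0 dP] := near_F _ h.
move: (h); rewrite oppr_gt0 ltNge => /negP; apply; apply: F1 => //; apply: coord => d' d'0.
have m0 : 0 < Num.min d d' by rewrite lt_min d0.
have [_ [q [_ _ _ + [_ qP]]]] := xP _ m0 (lateral i).
rewrite lt_min => /andP[qd qd']; exists q => //; move: qP.
rewrite /P -lift_ord_max liftK => -[//|] h1.
by have := dP _ qd; rewrite ltr_norml => /andP[]; lra.
Qed.

End cube_topology.

(** * Retraction onto the cube and truncated distances *)

Section unit_clamp.
Context {R : realType}.

Lemma lipschitz_continuous (V W : normedModType R) k (f : V -> W) :
  (forall x y, `|f x - f y| <= k * `|x - y|) -> continuous f.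
Proof.
move=> fk x B /nbhs_ballP[e e0 eB]; apply/nbhs_ballP.
have k0 : 0 < `|k| + 1 by rewrite ltr_wpDl.
exists (e / (`|k| + 1)) => [|y]; first by rewrite /= divr_gt0.
rewrite -ball_normE /= ltr_pdivlMr // => xy; apply: eB; rewrite -ball_normE /=.
apply: le_lt_trans (fk x y) (le_lt_trans _ xy).
by rewrite mulrC ler_wpM2l // (le_trans (ler_norm k)) // lerDl.
Qed.

Definition clamp01 (t : R) : R := Num.max 0 (Num.min 1 t).

Lemma clamp01P t : [\/ t <= 0 /\ clamp01 t = 0, 0 <= t <= 1 /\ clamp01 t = t |
  1 <= t /\ clamp01 t = 1].
Proof.
rewrite /clamp01; have [t0|t0] := leP t 0; first by constructor 1; rewrite min_r ?max_l //; lra.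
have [t1|t1] := leP t 1; last by constructor 3; rewrite max_r ?(ltW t1).
by constructor 2; rewrite max_r ?(ltW t0).
Qed.

Lemma clamp01_in t : 0 <= clamp01 t <= 1.
Proof. by have [] := clamp01P t => -[h ->]; lra. Qed.

Lemma clamp01_id t : 0 <= t <= 1 -> clamp01 t = t.
Proof. by have [] := clamp01P t => -[h ->] //; lra. Qed.

Lemma clamp01_lipschitz s t : `|clamp01 s - clamp01 t| <= `|s - t|.
Proof.
have [h|h] := leP s t.
  rewrite (distrC s) (distrC (clamp01 s)) !ger0_norm ?subr_ge0 //;
  by case: (clamp01P s) => -[hs ->]; case: (clamp01P t) => -[ht ->]; lra.
rewrite !ger0_norm ?subr_ge0 ?(ltW h) //;
by case: (clamp01P s) => -[hs ->]; case: (clamp01P t) => -[ht ->]; lra.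
Qed.

Lemma clamp01_continuous : continuous clamp01.
Proof.
apply: (@lipschitz_continuous R R 1) => s t.
by rewrite mul1r; exact: clamp01_lipschitz.
Qed.

Definition cube_proj n (x : 'rV[R]_n) : 'rV[R]_n := \row_i clamp01 (x ord0 i).

Lemma cube_proj_in n x : cube R n (cube_proj x).
Proof. by move=> i; rewrite mxE; exact: clamp01_in. Qed.

Lemma cube_proj_id n x : cube R n x -> cube_proj x = x.
Proof. by move=> cx; apply/rowP => i; rewrite mxE clamp01_id. Qed.

Lemma cube_proj_lipschitz n (x y : 'rV[R]_n) :
  `|cube_proj x - cube_proj y| <= `|x - y|.
Proof.
apply: rV_norm_le => // i; rewrite !mxE.
apply: le_trans (clamp01_lipschitz _ _) _.
by have := ler_coord (x - y) i; rewrite !mxE.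
Qed.

(* Distance to [A], truncated at 1 so as to make sense for empty [A]. *)
Definition dist1 n (A : set 'rV[R]_n) (x : 'rV[R]_n) : R :=
  inf ([set 1] `|` [set `|x - y| | y in A]).

Section dist1.
Variables (n : nat) (A : set 'rV[R]_n).
Implicit Types x y : 'rV[R]_n.

Let lb0 x : lbound ([set 1] `|` [set `|x - y| | y in A]) 0.
Proof. by move=> _ [->|[y _ <-]]. Qed.

Let ne x : ([set 1] `|` [set `|x - y| | y in A]) !=set0.
Proof. by exists 1; left. Qed.

Lemma dist1_ge0 x : 0 <= dist1 A x.
Proof. by apply: lb_le_inf. Qed.

Lemma dist1_le x y : A y -> dist1 A x <= `|x - y|.
Proof.
by move=> Ay; apply: ge_inf; [exists 0; exact: lb0 | right; exists y].
Qed.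

Lemma dist1_gt0 x e : 0 < e -> (forall y, A y -> e <= `|x - y|) ->
  0 < dist1 A x.
Proof.
move=> e0 h; apply: (@lt_le_trans _ _ (Num.min 1 e)); first by rewrite lt_min ltr01.
apply: lb_le_inf => // _ [->|[y Ay <-]]; first by rewrite ge_min lexx.
by rewrite ge_min h // orbT.
Qed.

Lemma dist1_eq0 x : closed A -> dist1 A x = 0 <-> A x.
Proof.
move=> cA; split=> [d0|Ax].
  apply: contrapT => nAx; have : open (~` A) by exact: closed_openC.
  rewrite openE => /(_ x nAx) /nbhs_ballP[e e0 eA].
  suff : 0 < dist1 A x by rewrite d0 ltxx.
  apply: (dist1_gt0 e0) => y Ay; rewrite leNgt; apply/negP => xy.
  by apply: (eA y) => //; rewrite -ball_normE.
by apply/eqP; rewrite eq_le dist1_ge0 andbT (le_trans (dist1_le x Ax)) // subrr normr0.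
Qed.

Lemma dist1_lipschitz x y : `|dist1 A x - dist1 A y| <= `|x - y|.
Proof.
have h u v : dist1 A u <= dist1 A v + `|u - v|.
  rewrite -lerBlDr; apply: lb_le_inf => // _ [->|[z Az <-]].
    rewrite lerBlDr (le_trans _ (ler_wpDr _ (lexx 1))) //.
    by apply: ge_inf; [exists 0; exact: lb0 | left].
  rewrite lerBlDr; apply: le_trans (dist1_le u Az) _.
  by rewrite [leRHS]addrC -(subrKA v u) ler_normD.
have := h x y; have := h y x; rewrite (distrC y) ler_norml => h1 h2.
by apply/andP; split; lra.
Qed.

Lemma dist1_continuous : continuous (dist1 A).
Proof.
apply: (@lipschitz_continuous 'rV[R]_n R 1) => x y; rewrite mul1r.
exact: dist1_lipschitz.
Qed.

End dist1.
End unit_clamp.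

(** * Homotopies on the lateral part of a separator *)

Section lateral_faces.
Context {R : realType}.

Lemma last_or_lateral n (P : 'I_n.+1 -> Prop) :
  P ord_max -> (forall i, P (lateral i)) -> forall j, P j.
Proof.
move=> Pm Pl j; case: (unliftP ord_max j) => [i ->|->] //.
by rewrite lift_ord_max.
Qed.

Definition lateral_faces n : set 'rV[R]_n.+1 :=
  [set x | exists i : 'I_n, x ord0 (lateral i) = 0 \/ x ord0 (lateral i) = 1].

Lemma comp_continuous (T U V : topologicalType) (f : T -> U) (g : U -> V) :
  continuous f -> continuous g -> continuous (fun x => g (f x)).
Proof. by move=> cf cg x; apply: (continuous_comp (cf x) (cg _)). Qed.

Lemma lateral_faces_closed n : closed (@lateral_faces n).
Proof.
have -> : @lateral_faces n = (fun x : 'rV[R]_n.+1 => \prod_(i <- enum 'I_n)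
   (x ord0 (lateral i) * (1 - x ord0 (lateral i)))) @^-1` [set 0].
  apply/seteqP; split=> x /=.
    move=> [i xi]; rewrite (big_rem i) ?mem_enum //=.
    by case: xi => ->; ring.
  move/eqP; rewrite prodf_seq_eq0 => /hasP[i _ /=].
  rewrite mulf_eq0 subr_eq0 => /orP[/eqP h|/eqP h]; exists i; first by left.
  by right.
apply: continuous_preimage_closed; last exact: closed_eq.
apply: continuous_big => [|i _ y]; first exact: mul_continuous.
apply: (@continuousM R 'rV[R]_n.+1 (fun x => x ord0 (lateral i))
  (fun x => 1 - x ord0 (lateral i))); first exact: coord_continuous.
apply: (@continuousB R R 'rV[R]_n.+1 (fun=> 1)); first exact: cst_continuous.
exact: coord_continuous.
Qed.

Lemma continuous_pair_within (T U V : topologicalType) (A : set T)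
    (f : T -> U) (g : T -> V) : {within A, continuous f} ->
  {within A, continuous g} -> {within A, continuous (fun x => (f x, g x))}.
Proof. by move=> cf cg x; apply: cvg_pair; [exact: cf | exact: cg]. Qed.

(* A homotopy on the lateral part of a separator between a map with the signs
   of the centred projection and a constant map must vanish: run it in collars
   around the lateral faces and continue it by the constant inside. *)
Lemma separator_homotopy_zero n (E : set 'rV[R]_n.+1) (Phi : 'rV[R]_n.+1 -> R)
    (H : 'I_n -> 'rV[R]_n.+1 * R -> R) (c : 'I_n -> R) :
  let L := E `&` @lateral_faces n in
  closed E -> E `<=` cube R n.+1 -> separating E Phi ->
  (forall i, {within L `*` `[0, 1], continuous (H i)}) ->
  (forall i x, L x -> H i (x, 1) = c i) ->
  (forall i x, L x -> x ord0 (lateral i) = 0 -> H i (x, 0) <= 0) ->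
  (forall i x, L x -> x ord0 (lateral i) = 1 -> 0 <= H i (x, 0)) ->
  (forall i, c i = 0) \/
  exists x t, [/\ L x, 0 <= t <= 1 & forall i, H i (x, t) = 0].
Proof.
move=> L cE Ecube [cPhi Phi0 Phi1 PhiE] cH H1 H00 H01.
(* [tau] stretches the middle third of each lateral coordinate over [0, 1] and collapses the outer
   thirds onto the faces; the last coordinate is kept, so that [Phi \o tau] still separates. *)
pose tau (x : 'rV[R]_n.+1) : 'rV[R]_n.+1 := \row_j
  if unlift ord_max j is Some i then clamp01 (3 * x ord0 j - 1) else x ord0 j.
(* [b] is 0 at 0 and 1, and 1 on the middle third. Their product [kap] is the homotopy time: 0 on
   the lateral faces and 1 in the core. *)
pose b t : R := clamp01 (3 * t + 0) * clamp01 (- 3 * t + 3).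
pose kap (x : 'rV[R]_n.+1) := \prod_(i <- enum 'I_n) b (x ord0 (lateral i)).
have tau_last x : tau x ord0 ord_max = x ord0 ord_max by rewrite mxE unlift_none.
have tau_lat x i : tau x ord0 (lateral i) = clamp01 (3 * x ord0 (lateral i) - 1).
  by rewrite mxE -lift_ord_max liftK.
have tau_cube x : cube R n.+1 x -> cube R n.+1 (tau x).
  move=> cx; apply: last_or_lateral => [|i]; first by rewrite tau_last.
  by rewrite tau_lat; exact: clamp01_in.
have clamp_aff (u v : R) : continuous (fun t : R => clamp01 (u * t + v)).
  apply: comp_continuous; last exact: clamp01_continuous.
  apply: (@lipschitz_continuous R R R `|u|) => s t.
  have -> : u * s + v - (u * t + v) = u * (s - t) by ring.
  by rewrite normrM.
have ctau : continuous tau.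
  apply: rV_continuous; apply: last_or_lateral => [|i].
    by under eq_fun do rewrite tau_last; exact: coord_continuous.
  under eq_fun do rewrite tau_lat.
  exact: (comp_continuous (@coord_continuous R 1 n.+1 _ _) (clamp_aff 3 (-1))).
have b01 t : 0 <= b t <= 1.
  have /andP[h1 h2] := clamp01_in (3 * t + 0).
  have /andP[h3 h4] := clamp01_in (- 3 * t + 3).
  by rewrite mulr_ge0 //= mulr_ile1.
have cb : continuous b.
  move=> t; apply: (@continuousM R R (fun t => clamp01 (3 * t + 0))
    (fun t => clamp01 (- 3 * t + 3))); exact: clamp_aff.
have ckap : continuous kap.
  apply: continuous_big => [|i _]; first exact: mul_continuous.
  exact: (comp_continuous (@coord_continuous R 1 n.+1 _ _) cb).
have kap01 x : 0 <= kap x <= 1.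
  rewrite /kap; elim/big_ind: _ => [|u v /andP[u0 u1] /andP[v0 v1]|i _] //.
    by lra.
  by rewrite mulr_ge0 //= mulr_ile1.
have b_eq1 t : b t != 1 -> clamp01 (3 * t - 1) = 0 \/ clamp01 (3 * t - 1) = 1.
  move=> b1; case: (clamp01P (3 * t - 1)) => -[h ->]; [by left| |by right].
  move: b1; rewrite /b.
  case: (clamp01P (3 * t + 0)) => -[h1 ->]; case: (clamp01P (- 3 * t + 3)) => -[h2 ->];
    by rewrite ?mulr1 ?eqxx //; lra.
(* Where [kap] is not 1, some lateral coordinate is outside the middle third and [tau] sends it to a
   face; over [E], the homotopy is then evaluated on [L]. *)
have kap_eq1 x : kap x != 1 -> lateral_faces (tau x).
  move=> kx; have [i bi] : exists i, b (x ord0 (lateral i)) != 1.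
    apply: contrapT => /forallNP nb; move: kx; rewrite /kap big1 ?eqxx // => i _.
    by apply/eqP; have /negP := nb i; rewrite negbK.
  by exists i; rewrite tau_lat; exact: b_eq1.
have kap_face (x : 'rV[R]_n.+1) (i : 'I_n) :
    x ord0 (lateral i) = 0 \/ x ord0 (lateral i) = 1 -> kap x = 0.
  move=> xi; rewrite /kap (big_rem i) ?mem_enum //= /b.
  have c0 (t : R) : t = 0 -> clamp01 t = 0 by move=> ->; rewrite clamp01_id // lexx ler01.
  by case: xi => ->; [rewrite (c0 (3 * 0 + 0)) | rewrite (c0 (- 3 * 1 + 3))];
    rewrite ?mulr0 ?mul0r //; lra.
pose E2 := cube R n.+1 `&` tau @^-1` E.
have cE2 : closed E2.
  apply: closedI; first exact: cube_closed.
  exact: continuous_preimage_closed.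
(* The two formulas agree where both apply, because [H] at time 1 is [c]. *)
pose F i x := if kap x == 1 then c i else H i (tau x, kap x).
have E2E : E2 = (E2 `&` kap @^-1` [set 1]) `|` (cube R n.+1 `&` tau @^-1` L).
  apply/seteqP; split=> x.
    move=> [cx Ex]; have [k1|/kap_eq1 h] := eqVneq (kap x) 1; first by left.
    by right.
  by move=> [[]|[? []]].
have cF i : {within E2, continuous (F i)}.
  rewrite E2E; apply: withinU_continuous.
  - apply: closedI => //.
    by apply: continuous_preimage_closed ckap _; exact: closed_eq.
  - apply: closedI; first exact: cube_closed.
    apply: continuous_preimage_closed => //.
    by apply: closedI => //; exact: lateral_faces_closed.
  - apply: (@subspace_eq_continuous _ _ _ (fun=> c i)); last exact: cst_continuous.
    by move=> x; rewrite inE => -[_ k1]; rewrite /from_subspace /F; case: eqP.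
  - apply: (@subspace_eq_continuous _ _ _ (fun x => H i (tau x, kap x))).
      move=> x; rewrite inE => -[cx Lx]; rewrite /from_subspace /F.
      by case: eqP => // ->; exact: H1.
    apply: (within_comp (f := fun x => (tau x, kap x)) _ (cH i)).
      by apply: continuous_pair_within; exact: continuous_subspaceT.
    by move=> _ [x [cx Lx] <-]; split=> //=; rewrite in_itv /= kap01.
have E2L (x : 'rV[R]_n.+1) (i : 'I_n) : E2 x ->
    x ord0 (lateral i) = 0 \/ x ord0 (lateral i) = 1 ->
    F i x = H i (tau x, 0) /\ L (tau x).
  move=> [cx Ex] /kap_face k0; rewrite /F k0 eq_sym oner_eq0; split=> //.
  by split=> //; apply: kap_eq1; rewrite k0 eq_sym oner_eq0.
have cl0 (t : R) : t <= 0 -> clamp01 t = 0.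
  by move=> t0; case: (clamp01P t) => -[h ->] //; lra.
have cl1 (t : R) : 1 <= t -> clamp01 t = 1.
  by move=> t0; case: (clamp01P t) => -[h ->] //; lra.
have [||||x [E2x _ Fx]] := @separator_common_zero R n E2 (Phi \o tau) F cE2 _ _ cF.
- by move=> x [].
- split=> [|x cx x0|x cx x0|x cx /= Px]; first exact: comp_continuous.
  + by apply: Phi0; [exact: tau_cube | rewrite tau_last].
  + by apply: Phi1; [exact: tau_cube | rewrite tau_last].
  + by split=> //; apply: PhiE => //; exact: tau_cube.
- move=> i x E2x xi; have [|-> Lx] := E2L x i E2x; first by left.
  by apply: H00 => //; rewrite tau_lat xi cl0 //; lra.
- move=> i x E2x xi; have [|-> Lx] := E2L x i E2x; first by right.
  by apply: H01 => //; rewrite tau_lat xi cl1 //; lra.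
have [k1|k1] := eqVneq (kap x) 1.
  by left => i; have := Fx i; rewrite /F k1 eqxx.
right; exists (tau x), (kap x); split=> //; first by case: E2x => _ Ex; split=> //; exact: kap_eq1.
by move=> i; have := Fx i; rewrite /F (negbTE k1).
Qed.

End lateral_faces.

(** * Cutting sets and separating functions *)

Section cuts.
Context {R : realType} {n : nat}.
Notation V := 'rV[R]_n.+1.
Implicit Types (x y : V) (C E : set V) (g : R -> V).

Definition cube_bottom : set V := [set x | cube R n.+1 x /\ x ord0 ord_max = 0].
Definition cube_top : set V := [set x | cube R n.+1 x /\ x ord0 ord_max = 1].

Definition crosses g (a b : R) :=
  path_range g a b `&` cube_bottom !=set0 /\ path_range g a b `&` cube_top !=set0.

Definition cuts_cube C := forall g a b, is_path g a b ->
  path_range g a b `<=` cube R n.+1 -> crosses g a b ->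
  path_range g a b `&` C !=set0.

Lemma cube_convex x y (t : R) : cube R n.+1 x -> cube R n.+1 y -> 0 <= t <= 1 ->
  cube R n.+1 (x + t *: (y - x)).
Proof.
move=> cx cy /andP[t0 t1] i; rewrite !mxE.
have /andP[x0 x1] := cx i; have /andP[y0 y1] := cy i.
have -> : x ord0 i + t * (y ord0 i - x ord0 i) =
  (1 - t) * x ord0 i + t * y ord0 i by ring.
have h : 0 <= 1 - t by rewrite subr_ge0.
rewrite addr_ge0 ?mulr_ge0 //=.
by apply: le_trans (_ : (1 - t) * 1 + t * 1 <= 1); [rewrite lerD ?ler_wpM2l | lra].
Qed.

Lemma sign_change (u : R -> R) (a b s t : R) :
  {within `[a, b], continuous u} -> a <= s <= b -> a <= t <= b ->
  u s <= 0 -> 0 <= u t -> exists2 r, a <= r <= b & u r = 0.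
Proof.
move=> cu sab tab us ut.
have H (p q : R) : a <= p <= b -> a <= q <= b -> p <= q ->
    Num.min (u p) (u q) <= 0 <= Num.max (u p) (u q) ->
    exists2 r, a <= r <= b & u r = 0.
  move=> /andP[ap pb] /andP[aq qb] pq upq.
  have cpq : {within `[p, q], continuous u}.
    apply: continuous_subspaceW cu => r /=; rewrite !in_itv /=; lra.
  by have [r] := IVT pq cpq upq; rewrite in_itv /= => hr ur; exists r => //; lra.
have [st|ts] := leP s t.
  by apply: (H s t) => //; rewrite ge_min us le_max ut orbT.
by apply: (H t s) => //; rewrite ?(ltW ts) // ge_min us le_max ut orbT.
Qed.

Lemma separating_cuts C Phi : separating C Phi -> cuts_cube C.
Proof.
move=> [cPhi Phi0 Phi1 PhiC] g a b [_ cg] gcube.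
move=> [[_ [[s /= sab <-] [cs s0]]] [_ [[t /= tab <-] [ct t1]]]].
rewrite !in_itv /= in sab tab.
have [|||r rab ur] := @sign_change (Phi \o g) a b s t _ sab tab.
- by apply: (within_comp cg (continuous_subspaceT (A := setT) cPhi)).
- exact: Phi0.
- exact: Phi1.
have gr : path_range g a b (g r) by exists r => //=; rewrite in_itv.
by exists (g r); split=> //; apply: PhiC => //; exact: gcube.
Qed.

Let reach C x := cube R n.+1 x /\ exists g a b,
  [/\ is_path g a b, path_range g a b `<=` cube R n.+1 `&` ~` C,
      cube_bottom (g a) & g b = x].

Let reach_segment C x y : reach C x -> cube R n.+1 y ->
  (forall t : R, 0 <= t <= 1 -> ~ C (x + t *: (y - x))) -> reach C y.
Proof.
move=> [cx [g [a [b [[ab cg] gC ga gb]]]]] cy xyC; split=> //.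
pose l (t : R) := x + (t - b) *: (y - x).
exists (fun t => if t <= b then g t else l t), a, (b + 1); split.
- split; first by lra.
  have -> : `[a, b + 1]%classic = `[a, b] `|` `[b, b + 1].
    apply/seteqP; split=> t /=; rewrite !in_itv /=; last by move=> []; lra.
    by move=> h; have [tb|tb] := leP t b; [left|right]; lra.
  apply: withinU_continuous; try exact: itv_closed.
    apply: (subspace_eq_continuous _ cg) => t.
    by rewrite inE /= in_itv /= /from_subspace => /andP[_ ->].
  apply: (@subspace_eq_continuous _ _ _ l).
    move=> t; rewrite inE /= in_itv /= /from_subspace => h.
    case: ifP => // tb; have -> : t = b by lra.
    by rewrite /l subrr scale0r addr0.
  apply/continuous_subspaceT/(@lipschitz_continuous R R^o V `|y - x|) => s t.
  rewrite /l opprD addrACA subrr add0r -scalerBl normrZ mulrC.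
  by rewrite (_ : s - b - (t - b) = s - t) //; ring.
- move=> z [t /= h <-]; rewrite in_itv /= in h.
  have [tb|tb] := leP t b.
    by apply: gC; exists t => //=; rewrite in_itv /=; lra.
  have h1 : 0 <= t - b <= 1 by lra.
  by split; [exact: cube_convex | exact: xyC].
- by rewrite ab.
- have -> : (b + 1 <= b) = false by apply/negbTE; rewrite -ltNge; lra.
  by rewrite /l addrAC subrr add0r scale1r addrC subrK.
Qed.

(** [Phi] is the distance to [C], negated at the points joined to the bottom off [C]. A top point
    joined to the bottom would give a path that misses [C]; clamping to the cube extends [Phi] to
    the whole space. *)
Lemma cuts_separating C : closed C -> C `<=` cube R n.+1 -> cuts_cube C ->
  exists Phi, separating C Phi.
Proof.
move=> cC Ccube cutC.
pose sg x : R := if `[< reach C x >] then - dist1 C x else dist1 C x.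
have sgC x : sg x = 0 -> C x.
  rewrite /sg; case: ifP => _ => [/eqP|]; last by move/(dist1_eq0 _ cC).
  by rewrite oppr_eq0 => /eqP /(dist1_eq0 _ cC).
(* The segment from a reachable to an unreachable point meets [C], so the two distances add up to at
   most its length: the signed distance is 1-Lipschitz across the change of sign. *)
have opp x y : reach C x -> ~ reach C y -> cube R n.+1 y ->
    dist1 C x + dist1 C y <= `|x - y|.
  move=> rx ry cy.
  have [t [t01 Ct]] : exists t : R, 0 <= t <= 1 /\ C (x + t *: (y - x)).
    apply: contrapT => /forallNP h; apply: ry; apply: reach_segment rx cy _.
    by move=> t t01 Ct; apply: (h t).
  apply: le_trans (lerD (dist1_le x Ct) (dist1_le y Ct)) _.
  have -> : x - (x + t *: (y - x)) = t *: (x - y).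
    by rewrite opprD addrA subrr add0r -scalerN opprB.
  have -> : y - (x + t *: (y - x)) = (1 - t) *: (y - x).
    by rewrite scalerBl scale1r opprD addrA.
  rewrite !normrZ (distrC y) -mulrDl !ger0_norm ?subr_ge0; [|lra..].
  by rewrite addrC subrK mul1r.
have lip x y : cube R n.+1 x -> cube R n.+1 y -> `|sg x - sg y| <= `|x - y|.
  move=> cx cy; rewrite /sg; case: asboolP => rx; case: asboolP => ry.
  - by rewrite -opprD normrN; exact: dist1_lipschitz.
  - by rewrite -opprD normrN ger0_norm ?addr_ge0 ?dist1_ge0 //; exact: opp.
  - rewrite opprK ger0_norm ?addr_ge0 ?dist1_ge0 // addrC distrC.
    exact: opp.
  - exact: dist1_lipschitz.
exists (fun x => sg (cube_proj x)); split.
- apply: (@lipschitz_continuous R V R 1) => x y; rewrite mul1r.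
  apply: le_trans (lip _ _ _ _) (cube_proj_lipschitz x y); exact: cube_proj_in.
- move=> x cx x0; rewrite cube_proj_id // /sg; case: asboolP => [_|nr].
    by rewrite oppr_le0 dist1_ge0.
  suff Cx : C x by have /(dist1_eq0 _ cC) -> := Cx.
  apply: contrapT => nC; apply: nr; split=> //.
  exists (fun=> x), 0, 0; split=> //.
    by split=> //; apply: continuous_subspaceT; exact: cst_continuous.
  by move=> _ [t _ <-].
- move=> x cx x1; rewrite cube_proj_id // /sg; case: asboolP => [|_]; last exact: dist1_ge0.
  move=> [_ [g [a [b [pg gC ga gb]]]]]; exfalso.
  have ab : a <= b by case: pg.
  have ra : path_range g a b (g a) by exists a => //=; rewrite in_itv /= lexx.
  have rb : path_range g a b (g b) by exists b => //=; rewrite in_itv /= lexx ab.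
  have [||z [zg Cz]] := cutC g a b pg.
  + by move=> z /gC[].
  + by split; [exists (g a) | exists (g b); split => //; rewrite gb].
  + by have [_] := gC _ zg.
- by move=> x cx; rewrite cube_proj_id //; exact: sgC.
Qed.

(** The path is run, possibly backwards, from a time at the bottom to a time at the top, and
    clamping freezes it outside [0, 1], which makes it continuous on the whole line. *)
Lemma avoiding_path C : ~ cuts_cube C -> exists g,
  [/\ continuous g, forall t, cube R n.+1 (g t) /\ ~ C (g t),
      g 0 ord0 ord_max = 0 & g 1 ord0 ord_max = 1].
Proof.
move=> nC; have [g [a [b [pg [gcube [gx gC]]]]]] : exists g a b, is_path g a b /\
    path_range g a b `<=` cube R n.+1 /\ crosses g a b /\
    ~ (path_range g a b `&` C !=set0).
  apply: contrapT => h; apply: nC => g a b pg gcube gx; apply: contrapT => gC.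
  by apply: h; exists g, a, b.
move: gx => [[_ [[s /= sab <-] [cs s0]]] [_ [[t /= tab <-] [ct t1]]]].
rewrite !in_itv /= in sab tab.
pose k (r : R) := s + clamp01 r * (t - s).
have kab r : a <= k r <= b.
  rewrite /k; have /andP[c0 c1] := clamp01_in r; move: (clamp01 r) c0 c1 => c c0 c1.
  by nra.
have ck : continuous k.
  apply: (@lipschitz_continuous R R R `|t - s|) => p q; rewrite /k.
  rewrite opprD addrACA subrr add0r -mulrBl normrM mulrC ler_wpM2l //.
  exact: clamp01_lipschitz.
have [clamp0 clamp1] : clamp01 (0 : R) = 0 /\ clamp01 (1 : R) = 1.
  by rewrite !clamp01_id ?lexx ?ler01.
exists (g \o k); split.
- have : {within setT, continuous (g \o k)}.
    apply: (within_comp (continuous_subspaceT ck) pg.2).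
    by move=> _ [r _ <-] /=; rewrite in_itv /= kab.
  by move=> h x; have := h x; rewrite /continuous_at /= nbhs_subspaceT.
- move=> r /=; have gr : path_range g a b (g (k r)) by exists (k r) => //=; rewrite in_itv /= kab.
  by split; [exact: gcube | move=> Cr; apply: gC; exists (g (k r))].
- by rewrite /= /k clamp0 mul0r addr0.
- by rewrite /= /k clamp1 mul1r addrC subrK.
Qed.

(** The traces of the chain on a given path are nested nonempty compact sets. *)
Lemma cuts_bigcap_chain (F : set (set V)) : F !=set0 ->
  (forall C, F C -> closed C /\ cuts_cube C) -> total_on F subset ->
  cuts_cube (\bigcap_(C in F) C).
Proof.
move=> F0 FP Ftot g a b pg gcube gx; pose Q := path_range g a b.
have coQ : compact Q by apply: continuous_compact pg.2 (@segment_compact R a b).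
pose G := filter_from F (fun C => Q `&` C).
have GF : ProperFilter G.
  apply: filter_from_proper => [|C FC]; last by have [_ cut] := FP C FC; exact: cut.
  apply: filter_from_filter => // C1 C2 F1 F2.
  have [C12|C21] := Ftot _ _ F1 F2.
    by exists C1 => // x [Qx Cx]; do ! split => //; exact: C12.
  by exists C2 => // x [Qx Cx]; do ! split => //; exact: C21.
have [|p [Qp clp]] := coQ G GF.
  by have [C FC] := F0; exists C => // x [].
exists p; split=> // C FC; have [cC _] := FP C FC; apply: cC => B Bp.
have [|x [Cx Bx]] := clp C B _ Bp; first by exists C => // x [].
by exists x.
Qed.

Lemma minimal_cut (G : set V) : closed G -> cuts_cube G -> exists C,
  [/\ closed C, C `<=` G, cuts_cube C &
      forall C', C' `<=` C -> closed C' -> cuts_cube C' -> C' = C].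
Proof.
move=> cG cutG.
(* [Zorn_bigcup] yields sets maximal for inclusion, so it is applied to the part removed from
   [G]. *)
pose P (U : set V) := closed (G `\` U) /\ cuts_cube (G `\` U).
have [|U [[cO cutO] Omax]] := @Zorn_bigcup V P.
  move=> F FP Ftot.
  (* Including [G] itself covers the empty chain. *)
  pose F' := [set G] `|` [set G `\` U | U in F].
  have e : G `\` \bigcup_(X in F) X = \bigcap_(C in F') C.
    apply/seteqP; split=> x.
      by move=> [Gx nx] C [->|[U FO <-]] //; split=> // Ox; apply: nx; exists U.
    move=> h; split; first by apply: (h G); left.
    by move=> [U FO Ox]; have [] : (G `\` U) x by apply: h; right; exists U.
  have F'P C : F' C -> closed C /\ cuts_cube C.
    by move=> [->|[U /FP PO <-]].
  rewrite /P e; split; first by apply: closed_bigI => C /F'P[].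
  apply: cuts_bigcap_chain => //; first by exists G; left.
  move=> A B [->|[U1 F1 <-]] [->|[U2 F2 <-]].
  - by left.
  - by right; exact: subDsetl.
  - by left; exact: subDsetl.
  - by have [h|h] := Ftot _ _ F1 F2; [right|left]; exact: setDS.
exists (G `\` U); split=> //.
move=> C' C'C cC' cutC'.
apply/seteqP; split=> // x Gx; apply: contrapT => C'x.
have GC' : G `\` ~` C' = C'.
  apply/seteqP; split=> y; first by move=> [_ /contrapT].
  by move=> C'y; split; [case: (C'C _ C'y) | apply].
apply: (Omax (~` C')); last by rewrite /P GC'.
split; first by move=> y Oy /C'C[].
by move=> /(_ x C'x) Ox; case: Gx.
Qed.

End cuts.
Arguments cuts_cube {R n} C.

Section minimal_cuts.
Context {R : realType} {n : nat}.
Notation V := 'rV[R]_n.+1.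

(* If a minimal cut were the union of disjoint closed sets C1 and C2, there
   would be paths g1 and g2 from bottom to top avoiding C1 and C2; in the square
   swept by the segments from g1 to g2, C1 is then separated from the side g1
   and C2 from the side g2, against Poincaré–Miranda in dimension 2. *)
Lemma minimal_cut_connected (C : set V) :
  closed C -> C `<=` cube R n.+1 -> cuts_cube C ->
  (forall C', C' `<=` C -> closed C' -> cuts_cube C' -> C' = C) ->
  connected C.
Proof.
move=> cC Ccube cutC Cmin B [b Bb] [W oW BW] [F cF BF].
apply: contrapT => BC; pose C2 := C `&` ~` W.
have cB : closed B by rewrite BF; exact: closedI.
have cC2 : closed C2 by apply: closedI => //; exact: open_closedC.
have [g1 [cg1 g1P g10 g11]] : exists g : R -> V, [/\ continuous g,
    forall t, cube R n.+1 (g t) /\ ~ B (g t),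
    g 0 ord0 ord_max = 0 & g 1 ord0 ord_max = 1].
  by apply: avoiding_path => cutB; apply/BC/Cmin => // x; rewrite BF => -[].
have [g2 [cg2 g2P g20 g21]] : exists g : R -> V, [/\ continuous g,
    forall t, cube R n.+1 (g t) /\ ~ C2 (g t),
    g 0 ord0 ord_max = 0 & g 1 ord0 ord_max = 1].
  apply: avoiding_path => cutC2.
  have eC2 : C2 = C by apply: Cmin => // x [].
  have : C b by move: Bb; rewrite BF => -[].
  by rewrite -eC2 => -[_]; apply; move: Bb; rewrite BW => -[].
have [Phi [cPhi Phi0 Phi1 PhiC]] := cuts_separating cC Ccube cutC.
pose l0 : 'I_2 := lateral ord0.
(* The last coordinate is the time on both paths, the lateral one moves along the segment from [g1]
   to [g2]. *)
pose h (x : 'rV[R]_2) : V := g1 (x ord0 ord_max) +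
  x ord0 l0 *: (g2 (x ord0 ord_max) - g1 (x ord0 ord_max)).
have ch : continuous h.
  apply: rV_continuous => i.
  have e (g : R -> V) : continuous g ->
      continuous (fun x : 'rV[R]_2 => g (x ord0 ord_max) ord0 i).
    move=> cg; apply: (comp_continuous _ (@coord_continuous R 1 n.+1 ord0 i)).
    by apply: comp_continuous cg; exact: coord_continuous.
  under eq_fun do rewrite /h !mxE.
  move=> x; apply: (@continuousD R R 'rV[R]_2 (fun x => g1 (x ord0 ord_max) ord0 i)).
    exact: e.
  apply: (@continuousM R 'rV[R]_2 (fun x => x ord0 l0)).
    exact: coord_continuous.
  by apply: (@continuousB R R 'rV[R]_2 (fun x => g2 (x ord0 ord_max) ord0 i)); exact: e.
have hcube x : cube R 2 x -> cube R n.+1 (h x).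
  move=> cx; apply: cube_convex; last exact: cx.
    by case: (g1P (x ord0 ord_max)).
  by case: (g2P (x ord0 ord_max)).
have h0 (x : 'rV[R]_2) : x ord0 l0 = 0 -> ~ B (h x).
  by rewrite /h => ->; rewrite scale0r addr0; case: (g1P (x ord0 ord_max)).
have h1 (x : 'rV[R]_2) : x ord0 l0 = 1 -> ~ C2 (h x).
  by rewrite /h => ->; rewrite scale1r addrC subrK; case: (g2P (x ord0 ord_max)).
have closed_coord (i : 'I_2) (c : R) : closed [set x : 'rV[R]_2 | x ord0 i = c].
  exact: (continuous_preimage_closed (@coord_continuous R 1 2 ord0 i) (@closed_eq R c)).
have closed_h (A : set V) : closed A -> closed (h @^-1` A).
  exact: continuous_preimage_closed.
pose E := cube R 2 `&` h @^-1` (Phi @^-1` [set 0]).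
(* [S] and [T] are disjoint, as [g1] avoids [B] and [g2] avoids [C2], and any point sent into [C] is
   in one of them. So no such point is at equal distance from both, yet the difference of distances
   changes sign from one side to the other. *)
pose S := [set x : 'rV[R]_2 | x ord0 l0 = 0] `|` h @^-1` C2.
pose T := [set x : 'rV[R]_2 | x ord0 l0 = 1] `|` h @^-1` B.
have cS : closed S by apply: closedU; [exact: closed_coord | exact: closed_h].
have cT : closed T by apply: closedU; [exact: closed_coord | exact: closed_h].
have dS x : S x -> dist1 S x = 0 by move/(dist1_eq0 _ cS).
have dT x : T x -> dist1 T x = 0 by move/(dist1_eq0 _ cT).
have sepE : separating E (Phi \o h).
  split=> [|x cx x0|x cx x1|x cx px]; last by split.
  - exact: comp_continuous ch cPhi.
  - by apply: Phi0; [exact: hcube | rewrite !mxE x0 g10 g20; ring].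
  - by apply: Phi1; [exact: hcube | rewrite !mxE x1 g11 g21; ring].
have [|||||x [[cx /= px] _ /(_ ord0) /eqP]] := @separator_common_zero R 1 E (Phi \o h)
    (fun _ x => dist1 S x - dist1 T x) _ _ sepE.
- apply: closedI; first exact: cube_closed.
  exact: (closed_h _ (continuous_preimage_closed cPhi (@closed_eq R 0))).
- by move=> x [].
- move=> _; apply: continuous_subspaceT => x.
  by apply: (@continuousB R R 'rV[R]_2 (dist1 S)); exact: dist1_continuous.
- move=> i x _; rewrite (ord1 i) => xi; rewrite dS; last by left.
  by rewrite sub0r oppr_le0 dist1_ge0.
- move=> i x _; rewrite (ord1 i) => xi; rewrite [dist1 T _]dT; last by left.
  by rewrite subr0 dist1_ge0.
rewrite subr_eq0 => /eqP dST.
have Chx : C (h x) by apply: PhiC => //; exact: hcube.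
have ST : ~ (S x /\ T x).
  move=> [[x0|[_ nW]] [x1|]].
  - by have := oner_neq0 R; rewrite -x1 x0 eqxx.
  - exact: h0.
  - by apply: (h1 x x1); split.
  - by rewrite BW => -[_ /nW].
apply: ST; have [Wx|nWx] := pselect (W (h x)).
  have Tx : T x by right; rewrite /= BW.
  by split=> //; apply/(dist1_eq0 _ cS); rewrite dST dT.
have Sx : S x by right.
by split=> //; apply/(dist1_eq0 _ cT); rewrite -dST dS.
Qed.

End minimal_cuts.

(** * Stretching maps of the cube: composition and fixed points *)

Section stretching.
Context {R : realType} {n : nat}.
Notation V := 'rV[R]_n.+1.

(** Images of [K] are required to stay in the cube: this lets such maps be composed, and gives the
    lateral signs needed for fixed points. *)
Definition stretching (K : set V) (f : V -> V) :=
  [/\ closed K, K `<=` cube R n.+1, {within K, continuous f},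
      f @` K `<=` cube R n.+1 &
      forall g (a b : R), is_path g a b -> path_range g a b `<=` cube R n.+1 ->
        crosses g a b -> exists c d : R,
          [/\ [/\ a <= c, c <= d & d <= b], path_range g c d `<=` K &
              crosses (f \o g) c d]].

Lemma stretching_id : stretching (cube R n.+1) id.
Proof.
split=> //; first exact: cube_closed.
- by apply: continuous_subspaceT => x; exact: cvg_id.
- by move=> _ [x ? <-].
- by move=> g a b [ab cg] gcube gx; exists a, b; split=> //; split.
Qed.

Lemma subpath (T : topologicalType) (g : R -> T) (a b c d : R) :
  is_path g a b -> [/\ a <= c, c <= d & d <= b] -> is_path g c d.
Proof.
move=> [ab cg] [ac cd db]; split=> //; apply: continuous_subspaceW cg => t.
by rewrite /= !in_itv /=; lra.
Qed.

Lemma stretching_comp K1 K2 f1 f2 : stretching K1 f1 -> stretching K2 f2 ->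
  stretching (K1 `&` f1 @^-1` K2) (f2 \o f1).
Proof.
move=> [cK1 K1cube cf1 f1cube s1] [cK2 K2cube cf2 f2cube s2]; split.
- exact: closed_within_preimage.
- by move=> x [/K1cube].
- apply: (within_comp (B := K2)) cf2 _ => //; last by move=> _ [x [_ ?] <-].
  by apply: continuous_subspaceW cf1 => x [].
- by move=> _ [x [_ Kx] <-]; apply: f2cube; exists (f1 x).
- move=> g a b pg gcube gx; have [c [d [acd gK1 gcd]]] := s1 g a b pg gcube gx.
  have [|||c' [d' [acd' gK2 gcd']]] := s2 (f1 \o g) c d.
  + have [cd cgcd] := subpath pg acd; split=> //.
    apply: (within_comp cgcd cf1) => _ [t tcd <-]; apply: gK1; by exists t.
  + move=> _ [t tcd <-]; apply: f1cube; exists (g t) => //.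
    by apply: gK1; exists t.
  + exact: gcd.
  exists c', d'; case: acd acd' => ac cd db [cc' cd' d'd].
  split=> //; first by split=> //; lra.
  move=> _ [t t' <-]; split; last by apply: gK2; exists t.
  by apply: gK1; exists t => //; move: t'; rewrite /= !in_itv /=; lra.
Qed.

Lemma stretching_cuts K f : stretching K f -> cuts_cube K.
Proof.
move=> [_ _ _ _ s] g a b pg gcube gx; have [c [d [[ac cd db] gK _]]] := s g a b pg gcube gx.
exists (g c); split; first by exists c => //=; rewrite in_itv /=; lra.
by apply: gK; exists c => //=; rewrite in_itv /= lexx.
Qed.

Lemma stretching_fixpoint K f : stretching K f -> exists2 x, K x & f x = x.
Proof.
move=> [cK Kcube cf fcube s].
have ccoord i : {within K, continuous (fun x => f x ord0 i - x ord0 i)}.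
  move=> x; apply: (@continuousB R R (subspace K) (fun x => f x ord0 i)).
    have := @within_comp _ _ _ K setT f (fun y => y ord0 i) cf.
    move=> /(_ (continuous_subspaceT (@coord_continuous R 1 n.+1 ord0 i)) _ x).
    exact.
  by have := continuous_subspaceT (A := K) (@coord_continuous R 1 n.+1 ord0 i); exact.
pose E := K `&` (fun x => f x ord0 ord_max - x ord0 ord_max) @^-1` [set 0].
have cE : closed E by apply: closed_within_preimage => //; exact: closed_eq.
have EK : E `<=` K by move=> x [].
have Ecube : E `<=` cube R n.+1 by move=> x /EK /Kcube.
have cutE : cuts_cube E.
  move=> g a b pg gcube gx; have [c [d [acd gK gcd]]] := s g a b pg gcube gx.
  move: gcd => [[_ [[p /= pcd <-] [_ p0]]] [_ [[q /= qcd <-] [_ q1]]]].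
  rewrite !in_itv /= in pcd qcd.
  have gcd r : c <= r <= d -> K (g r) by move=> rcd; apply: gK; exists r => //=; rewrite in_itv.
  (* The last coordinate of [f \o g] takes the values 0 and 1 while that of [g] stays in [0, 1], so
     their difference changes sign. *)
  have [|||r rcd ur] := @sign_change R
    ((fun x => f x ord0 ord_max - x ord0 ord_max) \o g) c d p q _ pcd qcd.
  - have [_ cgcd] := subpath pg acd; apply: (within_comp cgcd (ccoord ord_max)).
    by move=> _ [r /= rcd <-]; apply: gcd; rewrite in_itv in rcd.
  - by rewrite /= p0 sub0r oppr_le0; have /andP[] := Kcube _ (gcd _ pcd) ord_max.
  - by rewrite /= q1 subr_ge0; have /andP[] := Kcube _ (gcd _ qcd) ord_max.
  exists (g r); split; last by split=> //; exact: gcd.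
  by exists r => //=; rewrite in_itv /=; case: acd => ? ? ?; lra.
have [Phi sepE] := cuts_separating cE Ecube cutE.
have fx x i : K x -> 0 <= f x ord0 i <= 1 by move=> Kx; apply: fcube; exists x.
(* The sign is reversed because f(x)_i - x_i is nonnegative where x_i = 0 and nonpositive where x_i
   = 1. *)
have [|||x [Ex _ Fx]] := @separator_common_zero R n E Phi
    (fun i x => - (f x ord0 (lateral i) - x ord0 (lateral i))) cE Ecube sepE.
- move=> i; apply: (continuous_subspaceW EK) => x.
  apply: (@continuousN R R (subspace K) (fun x => f x ord0 (lateral i) - x ord0 (lateral i))).
  exact: ccoord.
- by move=> i x /EK /fx h xi; have := h (lateral i); rewrite xi; lra.
- by move=> i x /EK /fx h xi; have := h (lateral i); rewrite xi; lra.
exists x; first exact: EK.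
apply/rowP; apply: last_or_lateral => [|i].
  by case: Ex => _ /eqP; rewrite subr_eq0 => /eqP.
by have := Fx i => /eqP; rewrite oppr_eq0 subr_eq0 => /eqP.
Qed.

End stretching.

(** * Itineraries *)

Section itineraries.
Context {R : realType} {n : nat} {I : Type}.
Notation V := 'rV[R]_n.+1.
Variables (K : I -> set V) (f : V -> V).
Hypothesis K_stretching : forall i, stretching (K i) f.

Definition itinerary_upto (s : nat -> I) k : set V :=
  [set x | cube R n.+1 x /\ forall i, (i < k)%N -> K (s i) (iter i f x)].

Definition itinerary (s : nat -> I) : set V :=
  [set x | cube R n.+1 x /\ forall i, K (s i) (iter i f x)].

Lemma itinerary_upto_stretching s k : stretching (itinerary_upto s k) (iter k f).
Proof.
elim: k => [|k IH].
  have -> : itinerary_upto s 0 = cube R n.+1 by apply/seteqP; split=> x // [].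
  exact: stretching_id.
have -> : itinerary_upto s k.+1 = itinerary_upto s k `&` iter k f @^-1` K (s k).
  apply/seteqP; split=> x.
    by move=> [cx h]; split; [split=> // i ik; apply: h; exact: ltnW | exact: h].
  move=> [[cx h] hk]; split=> // i; rewrite ltnS leq_eqVlt => /orP[/eqP -> //|].
  exact: h.
exact: stretching_comp.
Qed.

Lemma itinerary_bigcap s :
  itinerary s = \bigcap_(C in range (itinerary_upto s)) C.
Proof.
apply/seteqP; split=> x.
  by move=> [cx h] _ [k _ <-]; split.
move=> h; split=> [|i]; first by have [] := h (itinerary_upto s 0) (imageT _ _).
by have [_] := h (itinerary_upto s i.+1) (imageT _ _); apply.
Qed.

Lemma itinerary_closed s : closed (itinerary s).
Proof.
rewrite itinerary_bigcap; apply: closed_bigI => _ [k _ <-].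
by have [] := itinerary_upto_stretching s k.
Qed.

Lemma itinerary_cuts s : cuts_cube (itinerary s).
Proof.
have anti j k : (j <= k)%N -> itinerary_upto s k `<=` itinerary_upto s j.
  by move=> jk x [cx h]; split=> // i ij; apply: h; exact: leq_trans jk.
rewrite itinerary_bigcap; apply: cuts_bigcap_chain.
- by exists (itinerary_upto s 0); exists 0%N.
- move=> _ [k _ <-]; have sk := itinerary_upto_stretching s k.
  by split; [case: sk | exact: stretching_cuts sk].
- move=> _ _ [j _ <-] [k _ <-].
  by have [jk|kj] := leqP j k; [right|left]; apply: anti => //; exact: ltnW.
Qed.

Lemma periodic_itinerary s k : exists2 x,
  forall i, (i < k)%N -> K (s i) (iter i f x) & iter k f x = x.
Proof.
by have [x [_ h] fx] := stretching_fixpoint (itinerary_upto_stretching s k); exists x.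
Qed.

Lemma cuts_cube_neq0 (C : set V) : cuts_cube C -> C !=set0.
Proof.
pose g (t : R) : V := \row__ t.
have cg t : 0 <= t <= 1 -> cube R n.+1 (g t) by move=> t01 i; rewrite mxE.
move=> cutC; have [|||z [_ Cz]] := cutC g 0 1.
- split; first exact: ler01.
  apply/continuous_subspaceT/rV_continuous => i.
  by under eq_fun do rewrite mxE; move=> x; exact: cvg_id.
- by move=> _ [t t01 <-]; apply: cg; move: t01; rewrite /= in_itv.
- split; [exists (g 0) | exists (g 1)]; split.
  + by exists 0 => //=; rewrite in_itv /= lexx ler01.
  + by split; [apply: cg; rewrite lexx ler01 | rewrite mxE].
  + by exists 1 => //=; rewrite in_itv /= lexx ler01.
  + by split; [apply: cg; rewrite lexx ler01 | rewrite mxE].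
- by exists z.
Qed.

(* Orbits starting at time -k accumulate in the product topology. *)
Lemma bi_infinite_itinerary (s : int -> I) : exists w : int -> V,
  forall i, K (s i) (w i) /\ w (i + 1) = f (w i).
Proof.
have /choice[x xP] : forall k : nat, exists x,
    itinerary (fun j => s (j%:Z - k%:Z)) x.
  by move=> k; apply: cuts_cube_neq0; exact: itinerary_cuts.
(* Before time -k the absolute value gives a meaningless index, but the point is still in the cube,
   as compactness of the product requires; a fixed time [i] is meaningful as soon as [k] is at least
   its absolute value. *)
pose u (k : nat) : prod_topology (fun _ : int => V) :=
  fun i : int => iter (absz (i + k%:Z)) f (x k).
have ucube k i : cube R n.+1 (u k i).
  have [_ h] := xP k; have [_ Kcube _ _ _] := K_stretching (s ((absz (i + k%:Z))%:Z - k%:Z)).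
  exact/Kcube/h.
have [|w [wcube clw]] := @tychonoff int (fun=> V) (fun=> cube R n.+1)
    (fun=> @cube_compact R n.+1) (u @ \oo) _.
  by exists 0%N => // k _ i; exact: ucube.
exists w => i.
have near_w e N : 0 < e -> exists k, [/\ (N <= k)%N, `|w i - u k i| < e &
    `|w (i + 1) - u k (i + 1)| < e].
  move=> e0.
  have nb j : nbhs w [set v : prod_topology (fun _ : int => V) | ball (w j) e (v j)].
    exact: (@proj_continuous int (fun=> V) j w _ (nbhsx_ballx (w j) e e0)).
  have [|v [[k Nk <-] [h1 h2]]] := clw (u @` [set k | (N <= k)%N]) _ _
      (filterI (nb i) (nb (i + 1))).
    by exists N => // k Nk; exists k.
  by exists k; split=> //; move: h1 h2; rewrite /= -ball_normE.
have uK k : (`|i| <= k)%N -> K (s i) (u k i) /\ u k (i + 1) = f (u k i).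
  move=> ik; have [_ h] := xP k; split.
    have := h (absz (i + k%:Z)); suff -> : (absz (i + k%:Z))%:Z - k%:Z = i by [].
    by rewrite gez0_abs; lia.
  by rewrite /u -iterS; congr (iter _ _ _); lia.
have [cK _ /within_ballP cf _ _] := K_stretching (s i).
have Kw : K (s i) (w i).
  apply: cK => B /nbhs_ballP[e e0 eB].
  have [k [ik wk _]] := near_w e `|i|%N e0.
  exists (u k i); split; first by have [] := uK _ ik.
  by apply: eB; rewrite -ball_normE.
split=> //; apply/eqP; rewrite -subr_eq0 -normr_le0; apply/ler_addgt0Pr => e e0.
have e20 : 0 < e / 2 by rewrite divr_gt0.
have [d d0 dP] := cf _ Kw _ e20.
have m0 : 0 < Num.min d (e / 2) by rewrite lt_min d0.
have [k [ik]] := near_w _ `|i|%N m0; rewrite !lt_min => /andP[wd _] /andP[_ we].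
have [Ku uS] := uK _ ik.
have := dP _ Ku; rewrite -!ball_normE /= => /(_ wd) fe.
rewrite add0r -(subrKA (f (u k i))) (splitr e) (le_trans (ler_normD _ _)) //.
by apply: lerD; [rewrite -uS ltW | rewrite distrC ltW].
Qed.

End itineraries.

(** * Covering dimension of separators *)

Section dimension.
Context {R : realType} {n : nat}.
Notation V := 'rV[R]_n.+1.

(* From a refined cover of order at most k, a partition of unity on [E] lumped
   into n.+1 masses: a member of the cover contributes to the mass indexed by
   the first lateral face x_i = 0 which it meets, and to the last mass if it
   meets none. *)
Lemma face_masses (T : topologicalType) (E : set V) (rho : V -> T) (A : set T) k :
  hausdorff_space T -> closed E -> E `<=` cube R n.+1 ->
  {within E, continuous rho} -> {in E &, injective rho} -> rho @` E `<=` A ->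
  covering_dim_lt (set_type A) k ->
  exists mu : nat -> V -> R,
    [/\ forall l, continuous (mu l),
        forall l x, 0 <= mu l x,
        forall x, E x -> exists2 l, (l <= n)%N & 0 < mu l x,
        forall x (i : 'I_n), E x ->
          (x ord0 (lateral i) = 0 -> forall l, (i < l)%N -> mu l x = 0) /\
          (x ord0 (lateral i) = 1 -> mu i x = 0) &
        forall x p, E x -> (forall l, (l < p)%N -> 0 < mu l x) -> (p <= k)%N].
Proof.
move=> hT cE Ecube crho injrho rhoA dimA.
pose face (b : bool) (i : 'I_n) := E `&` [set x : V | x ord0 (lateral i) = b%:R].
have closed_face b i : closed (rho @` face b i).
  apply: compact_closed => //; apply: continuous_compact.
    by apply: continuous_subspaceW crho => x [].
  apply: (@subclosed_compact _ _ (cube R n.+1)); [|exact: cube_compact|by move=> x [/Ecube]].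
  apply: closedI => //.
  exact: (continuous_preimage_closed
    (@coord_continuous R 1 n.+1 ord0 (lateral i)) (@closed_eq R _)).
(* The points which avoid, for every [i], the face selected by [c i] among two opposite ones. Every
   point avoids one of the two, so these sets cover, and a member of a refinement never meets two
   opposite faces. *)
pose U (c : {ffun 'I_n -> bool}) : set (set_type A) :=
  set_val @^-1` (\bigcap_(i in [set: 'I_n]) ~` (rho @` face (c i) i)).
have [||q [W [oW Wcov Wref Word]]] := dimA #|{ffun 'I_n -> bool}| (fun j => U (enum_val j)).
- move=> j; exists (\bigcap_(i in [set: 'I_n]) ~` (rho @` face (enum_val j i) i)) => //.
  rewrite -closedC setC_bigcap; under eq_bigcupr do rewrite setCK.
  by apply: closed_bigcup => [|i _]; [exact: finite_finset | exact: closed_face].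
- apply/seteqP; split=> // a _.
  pose c := [ffun i : 'I_n => `[< (rho @` face false i) (set_val a) >]].
  exists (enum_rank c) => //; rewrite enum_rankK => i _ /=.
  rewrite ffunE; case: asboolP => // -[x [Ex x0] <-] [y [Ey y1] xy].
  have e : y = x by apply: injrho; rewrite ?inE.
  by move: y1 x0; rewrite e /= => -> /eqP; rewrite oner_eq0.
pose W' j : set V := E `&` [set x | exists2 a, W j a & set_val a = rho x].
have W'closed j : closed (E `\` W' j).
  have [B oB WB] := oW j.
  have -> : E `\` W' j = E `&` rho @^-1` (~` B).
    apply/seteqP; split=> x [Ex h]; split=> //.
      move=> Bx; apply: h; split=> //.
      have Ax : A (rho x) by apply: rhoA; exists x.
      exists (SigSub (mem_set Ax)); last by rewrite set_valE.
      by rewrite -WB /= set_valE.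
    by move=> [_ [a Wa ax]]; apply: h; move: Wa; rewrite -WB /= ax.
  by apply: closed_within_preimage => //; exact: open_closedC.
pose lam j := dist1 (E `\` W' j).
have lamW j x : E x -> 0 < lam j x <-> W' j x.
  move=> Ex; rewrite lt_neqAle dist1_ge0 andbT eq_sym; split=> [/eqP h|W'x].
    apply: contrapT => nW; apply: h.
    by have /(dist1_eq0 _ (W'closed j)) : (E `\` W' j) x by [].
  by apply/eqP => /(dist1_eq0 _ (W'closed j))[_].
have face_disj j i : ~ (exists2 x, W' j x & face false i x) \/
    ~ (exists2 x, W' j x & face true i x).
  have [l Wl] := Wref j; have h x b : W' j x -> face b i x -> enum_val l i != b.
    move=> [Ex [a Wa ax]] fx; apply/eqP => e.
    by have := Wl _ Wa i Logic.I; rewrite /= e ax; apply; exists x.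
  case e : (enum_val l i).
    by right=> -[x W'x fx]; have := h _ _ W'x fx; rewrite e.
  by left=> -[x W'x fx]; have := h _ _ W'x fx; rewrite e.
(* The class [n] collects the members meeting no face x_i = 0; a member of class [i < n] meets x_i =
   0, hence not x_i = 1. *)
pose first j c := [/\ (c <= n)%N,
  forall i : 'I_n, c = i -> ~ (exists2 x, W' j x & face true i x) &
  forall i : 'I_n, (exists2 x, W' j x & face false i x) -> (c <= i)%N].
have /choice[cls clsP] : forall j, exists c, first j c.
  move=> j; pose meets (c : nat) := [exists i : 'I_n, (i == c :> nat) &&
    `[< exists2 x, W' j x & face false i x >]].
  have [ex|nex] := pselect (exists c, meets c).
    case: (ex_minnP ex) => c /existsP[i /andP[/eqP ic /asboolP ix]] cmin.
    exists c; split; first by rewrite -ic ltnW.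
      move=> i' ci'; have -> : i' = i by apply/val_inj; rewrite /= -ci' ic.
      by have [|] := face_disj j i.
    by move=> i' i'x; apply: cmin; apply/existsP; exists i'; rewrite eqxx; exact/asboolP.
  exists n; split=> // [i ni|i ix]; first by have := ltn_ord i; rewrite -ni ltnn.
  by exfalso; apply: nex; exists i; apply/existsP; exists i; rewrite eqxx; exact/asboolP.
pose mu l x := \sum_(j | cls j == l) lam j x.
have mu_gt0 l x : 0 < mu l x -> exists2 j, cls j = l & 0 < lam j x.
  move=> mu0; apply: contrapT => h; move: mu0; rewrite /mu big1 ?ltxx // => j /eqP jl.
  apply/eqP; rewrite eq_le dist1_ge0 andbT leNgt; apply/negP => j0.
  by apply: h; exists j.
exists mu; split.
- move=> l; apply: continuous_big => [|j _]; first exact: add_continuous.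
  exact: dist1_continuous.
- by move=> l x; apply: sumr_ge0 => j _; exact: dist1_ge0.
- move=> x Ex; have Ax : A (rho x) by apply: rhoA; exists x.
  have : (\bigcup_j W j) (SigSub (mem_set Ax)) by rewrite Wcov.
  move=> [j _ Wj]; exists (cls j); first by have [] := clsP j.
  have lj : 0 < lam j x by apply/lamW => //; split=> //; exists (SigSub (mem_set Ax)).
  rewrite /mu (bigD1 j) //= ltr_wpDr //.
  by apply: sumr_ge0 => j' _; exact: dist1_ge0.
- move=> x i Ex; split=> [x0 l il|x1].
    apply/eqP; rewrite eq_le; apply/andP; split; last by apply: sumr_ge0 => j _; exact: dist1_ge0.
    rewrite leNgt; apply/negP => /mu_gt0[j jl /(lamW _ _ Ex) W'x].
    have [_ _ /(_ i) h] := clsP j.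
    by have := il; rewrite ltnNge -jl h //; exists x.
  apply/eqP; rewrite eq_le; apply/andP; split; last by apply: sumr_ge0 => j _; exact: dist1_ge0.
  rewrite leNgt; apply/negP => /mu_gt0[j jl /(lamW _ _ Ex) W'x].
  by have [_ /(_ i jl) h _] := clsP j; apply: h; exists x.
- move=> x p Ex mup.
  (* Positive masses of different indices come from different members of the cover containing
     [x]. *)
  have /choice[J JP] : forall l : 'I_p, exists j, cls j = l /\ 0 < lam j x.
    by move=> l; have [j] := mu_gt0 _ _ (mup l (ltn_ord l)); exists j.
  have Jinj : injective J.
    by move=> l l' e; apply/val_inj; rewrite /= -(JP l).1 -(JP l').1 e.
  have Ax : A (rho x) by apply: rhoA; exists x.
  apply: leq_trans (Word (SigSub (mem_set Ax))).
  rewrite -[p]card_ord -(card_imset _ Jinj); apply/subset_leq_card/fintype.subsetP.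
  move=> _ /imsetP[l _ ->]; rewrite inE; apply/asboolP.
  have /(lamW _ _ Ex)[_ [a Wa ax]] := (JP l).2.
  have -> : SigSub (mem_set Ax) = a by apply/val_inj; exact: esym ax.
  exact/asboolP.
Qed.

(* [mass_gap m i] vanishes for all [i < n] only when m is proportional to
   (2^(n-1), ..., 2, 1, 1). *)
Definition mass_gap (m : nat -> R) (i : 'I_n) : R :=
  \sum_(l < n.+1 | (i < l)%N) m l - m i.

(** Every mass equals the sum of the later ones. Going down from [n], a positive last mass makes all
    positive, and a zero one makes all vanish. *)
Lemma mass_gap_eq0 (m : nat -> R) : (forall l, 0 <= m l) ->
  (exists2 l, (l <= n)%N & 0 < m l) -> (forall i, mass_gap m i = 0) ->
  forall l, (l <= n)%N -> 0 < m l.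
Proof.
move=> m0 [l0 l0n ml0] gap0.
have mE (i : 'I_n) : m i = \sum_(l < n.+1 | (i < l)%N) m l.
  by have /eqP := gap0 i; rewrite subr_eq0 => /eqP.
have [mn|mn] := ltP 0 (m n).
  move=> l; rewrite leq_eqVlt => /orP[/eqP -> //|ln].
  rewrite (mE (Ordinal ln)) (bigD1 ord_max) //= ltr_wpDr //.
  by apply: sumr_ge0.
suff h : forall d l, (l <= n)%N -> (n - l <= d)%N -> m l = 0.
  by move: ml0; rewrite (h n l0) ?ltxx // leq_subr.
elim=> [|d IH] l ln nd.
  have -> : l = n by lia.
  by apply/eqP; rewrite eq_le mn m0.
have [e|nl] := eqVneq l n; first by apply: IH => //; lia.
have ltln : (l < n)%N by rewrite ltn_neqAle nl.
rewrite (mE (Ordinal ltln)) big1 // => l' /= ll'.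
by apply: IH; have := ltn_ord l'; lia.
Qed.

(** The gaps have the right signs: on x_i = 0 the masses after [i] vanish, on x_i = 1 the mass [i]
    does. At a common zero all [n.+1] masses are positive. The map [rho] allows the covered set to
    lie in another space. *)
Lemma separator_dim (T : topologicalType) (E : set V) (Phi : V -> R)
    (rho : V -> T) (A : set T) k :
  hausdorff_space T -> closed E -> E `<=` cube R n.+1 -> separating E Phi ->
  {within E, continuous rho} -> {in E &, injective rho} -> rho @` E `<=` A ->
  covering_dim_lt (set_type A) k -> (n < k)%N.
Proof.
move=> hT cE Ecube sepE crho injrho rhoA dimA.
have [mu [cmu mu0 mupos muface muord]] :=
  face_masses hT cE Ecube crho injrho rhoA dimA.
have [|||x [Ex _ Fx]] := @separator_common_zero R n E Phi
    (fun i x => mass_gap (mu ^~ x) i) cE Ecube sepE.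
- move=> i; apply: continuous_subspaceT => x; rewrite /mass_gap.
  apply: (@continuousB R R V (fun x => \sum_(l < n.+1 | (i < l)%N) mu l x)); last exact: cmu.
  by apply: continuous_big => //; exact: add_continuous.
- move=> i x Ex xi; rewrite /mass_gap big1 ?sub0r ?oppr_le0 // => l il.
  by have [h _] := muface x i Ex; exact: h.
- move=> i x Ex xi; have [_ h] := muface x i Ex; rewrite /mass_gap h // subr0.
  exact: sumr_ge0.
apply: (muord x) => // l ln.
by apply: (@mass_gap_eq0 (mu ^~ x)) => //; exact: mupos.
Qed.

(** The masses are deformed linearly into a unit mass at index [n], for which all gaps equal 1. As
    [n > 0] this constant is not zero, so the homotopy vanishes somewhere. *)
Lemma separator_lateral_dim (T : topologicalType) (E : set V) (Phi : V -> R)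
    (rho : V -> T) (A : set T) k :
  let L := E `&` @lateral_faces R n in (0 < n)%N ->
  hausdorff_space T -> closed E -> E `<=` cube R n.+1 -> separating E Phi ->
  {within L, continuous rho} -> {in L &, injective rho} -> rho @` L `<=` A ->
  covering_dim_lt (set_type A) k -> (n <= k)%N.
Proof.
move=> L n0 hT cE Ecube sepE crho injrho rhoA dimA.
have cL : closed L by apply: closedI => //; exact: lateral_faces_closed.
have Lcube : L `<=` cube R n.+1 by move=> x [/Ecube].
have [mu [cmu mu0 mupos muface muord]] :=
  face_masses hT cL Lcube crho injrho rhoA dimA.
pose m (x : V) (t : R) l := (1 - t) * mu l x + t * (l == n)%:R.
pose H i (xt : V * R) := mass_gap (m xt.1 xt.2) i.
have cm l : continuous (fun xt : V * R => m xt.1 xt.2 l).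
  move=> xt; rewrite /m.
  apply: (@continuousD R R (V * R)%type (fun xt => (1 - xt.2) * mu l xt.1)).
    apply: (@continuousM R (V * R)%type (fun xt => 1 - xt.2)).
      apply: (@continuousB R R (V * R)%type (fun=> 1)); last exact: cvg_snd.
      exact: cst_continuous.
    by apply: (@continuous_comp (V * R)%type V R fst); [exact: cvg_fst | exact: cmu].
  by apply: (@continuousM R (V * R)%type snd); [exact: cvg_snd | exact: cst_continuous].
have H0 i x : H i (x, 0) = mass_gap (mu ^~ x) i.
  rewrite /H /mass_gap /m /= subr0; congr (_ - _); last by rewrite mul1r mul0r addr0.
  by apply: eq_bigr => l _; rewrite mul1r mul0r addr0.
have H1 i x : H i (x, 1) = 1.
  rewrite /H /mass_gap /m /= subrr (bigD1 ord_max) ?ltn_ord //= eqxx big1.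
    by rewrite (ltn_eqF (ltn_ord i)) !mul0r !add0r !mul1r addr0 subr0.
  move=> l /andP[_ ln]; rewrite (_ : (l == n :> nat) = false) ?mul0r ?mulr0 ?addr0 //.
  by apply: contraNF ln => /eqP ln; apply/eqP/val_inj.
have [||||c0|[x [t [Lx t01 Hx]]]] := @separator_homotopy_zero R n E Phi H (fun=> 1)
    cE Ecube sepE.
- move=> i; apply: continuous_subspaceT => xt; rewrite /H /mass_gap.
  apply: (@continuousB R R (V * R)%type (fun xt => \sum_(l < n.+1 | (i < l)%N) m xt.1 xt.2 l)).
    by apply: continuous_big => //; exact: add_continuous.
  exact: cm.
- by move=> i x _; exact: H1.
- move=> i x Lx xi; rewrite H0 /mass_gap big1 ?sub0r ?oppr_le0 // => l il.
  by have [h _] := muface x i Lx; exact: h.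
- move=> i x Lx xi; have [_ h] := muface x i Lx; rewrite H0 /mass_gap h // subr0.
  exact: sumr_ge0.
- by have := c0 (Ordinal n0) => /eqP; rewrite oner_eq0.
have /andP[t0 t1] := t01.
have m0 l : 0 <= m x t l.
  by rewrite addr_ge0 ?mulr_ge0 ?subr_ge0.
have mpos : exists2 l, (l <= n)%N & 0 < m x t l.
  have [t1'|t1'] := ltP t 1.
    have [l ln mul] := mupos _ Lx; exists l => //.
    by rewrite ltr_wpDr ?mulr_ge0 // mulr_gt0 ?subr_gt0.
  exists n => //; have -> : t = 1 by lra.
  by rewrite /m subrr mul0r add0r eqxx mulr1.
have mall := mass_gap_eq0 m0 mpos Hx.
apply: (muord x) => // l ln; have := mall l (ltnW ln).
(* The deformation feeds only the index [n], so positivity passes back to the original masses for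
   [l < n]: this gives [n] of them, one less than on the whole separator. *)
rewrite /m (ltn_eqF ln) mulr0 addr0 => h.
by rewrite lt_neqAle mu0 andbT; apply: contraTneq h => <-; rewrite mulr0 ltxx.
Qed.

End dimension.

(** * Dimension of a minimal cut at each of its points *)

Section local_dimension.
Context {R : realType} {n : nat}.
Notation V := 'rV[R]_n.+1.
Variables (C : set V) (Phi : V -> R).
Hypotheses (C_closed : closed C) (C_cube : C `<=` cube R n.+1).
Hypothesis C_min :
  forall C', C' `<=` C -> closed C' -> cuts_cube C' -> C' = C.
Hypothesis C_Phi : separating C Phi.

(* Adding to [Phi] a bump at [x0] of the right sign would otherwise make
   [C] minus a ball separating. *)
Lemma minimal_cut_signs x0 e : C x0 -> 0 < e ->
  (exists p, [/\ cube R n.+1 p, `|p - x0| < e & Phi p < 0 \/ p ord0 ord_max = 0]) /\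
  (exists q, [/\ cube R n.+1 q, `|q - x0| < e & 0 < Phi q \/ q ord0 ord_max = 1]).
Proof.
move=> Cx0 e0; have [cPhi Phi0 Phi1 PhiC] := C_Phi.
pose b x : R := Num.max 0 (e - `|x - x0|).
have cb : continuous b.
  apply: (@lipschitz_continuous R V R 1) => x y; rewrite mul1r /b.
  apply: (@le_trans _ _ (`| `|x - x0| - `|y - x0| |)); last first.
    apply: le_trans (ler_dist_dist _ _) _.
    by rewrite opprB addrA subrK.
  move: `|x - x0| `|y - x0| => u v.
  have [h1|h1] := leP 0 (e - u); have [h2|h2] := leP 0 (e - v);
    rewrite ?subrr ?normr0 ?normr_ge0 // ler_norml; have [h3|h3] := leP 0 (u - v);
    rewrite ?(ger0_norm h3) ?(ltr0_norm h3); apply/andP; split; lra.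
have b_far x : e <= `|x - x0| -> b x = 0 by move=> h; rewrite /b max_l // subr_le0.
have b_near x : `|x - x0| < e -> 0 < b x.
  by move=> h; rewrite /b lt_max subr_gt0 h orbT.
pose C' := C `&` [set x | e <= `|x - x0|].
have nsep Psi : ~ separating C' Psi.
  move=> /separating_cuts cutC'; have : C' x0.
    rewrite (C_min _ _ cutC') //; first by move=> x [].
    apply: closedI => //.
    exact: (continuous_preimage_closed (@dist_continuous R n.+1 x0) (@closed_ge R e)).
  by move=> [_ /=]; rewrite subrr normr0 leNgt e0.
split; apply: contrapT => h.
  have {}h x : cube R n.+1 x -> `|x - x0| < e -> 0 <= Phi x /\ x ord0 ord_max != 0.
    move=> cx xe; split.
      by rewrite leNgt; apply/negP => px; apply: h; exists x; split=> //; left.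
    by apply/eqP => x1; apply: h; exists x; split=> //; right.
  apply: (nsep (fun x => Phi x + b x)); split.
  - by move=> x; apply: (@continuousD R R V Phi); [exact: cPhi | exact: cb].
  - move=> x cx xN; have [xe|xe] := leP e `|x - x0|; last first.
      by have [_] := h x cx xe; rewrite xN eqxx.
    by rewrite b_far // addr0; exact: Phi0.
  - by move=> x cx xN; rewrite addr_ge0 ?Phi1 // /b le_max lexx.
  - move=> x cx; have [xe|xe] := leP e `|x - x0|; last first.
      by have [px _] := h x cx xe; have := b_near x xe; lra.
    by rewrite b_far // addr0 => /(PhiC _ cx).
have {}h x : cube R n.+1 x -> `|x - x0| < e -> Phi x <= 0 /\ x ord0 ord_max != 1.
  move=> cx xe; split.
      by rewrite leNgt; apply/negP => px; apply: h; exists x; split=> //; left.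
  by apply/eqP => x1; apply: h; exists x; split=> //; right.
apply: (nsep (fun x => Phi x - b x)); split.
- by move=> x; apply: (@continuousB R R V Phi); [exact: cPhi | exact: cb].
- move=> x cx xN; have := Phi0 x cx xN; suff : 0 <= b x by lra.
  by rewrite /b le_max lexx.
- move=> x cx xN; have [xe|xe] := leP e `|x - x0|; last first.
    by have [_] := h x cx xe; rewrite xN eqxx.
  by rewrite b_far // subr0; exact: Phi1.
- move=> x cx; have [xe|xe] := leP e `|x - x0|; last first.
    by have [px _] := h x cx xe; have := b_near x xe; lra.
  by rewrite b_far // subr0 => /(PhiC _ cx).
Qed.

Let slab : set V := [set x | forall i : 'I_n, 0 <= x ord0 (lateral i) <= 1].

(* [Phi] continued to the two half-cylinders below and above the cube, where it
   does not vanish. *)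
Let Phi_ext (x : V) : R := Phi (cube_proj x) + (x ord0 ord_max - clamp01 (x ord0 ord_max)).

Let Phi_ext_continuous : continuous Phi_ext.
Proof.
have [cPhi _ _ _] := C_Phi => x.
apply: (@continuousD R R V (fun x => Phi (cube_proj x))).
  apply: comp_continuous cPhi x.
  apply: (@lipschitz_continuous R V V 1) => x y.
  by rewrite mul1r; exact: cube_proj_lipschitz.
apply: (@continuousB R R V (fun x => x ord0 ord_max)).
  exact: coord_continuous.
exact: (comp_continuous (@coord_continuous R 1 n.+1 ord0 ord_max) (@clamp01_continuous R)).
Qed.

Let slab_cube x : slab x -> 0 <= x ord0 ord_max <= 1 -> cube R n.+1 x.
Proof. by move=> sx xN; exact: last_or_lateral. Qed.

Let Phi_ext_eq0 x : slab x -> Phi_ext x = 0 -> C x.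
Proof.
have [_ Phi0 Phi1 PhiC] := C_Phi; move=> sx; rewrite /Phi_ext.
have := cube_proj_in x; case: (clamp01P (x ord0 ord_max)) => -[h e] cp; rewrite e.
- have := Phi0 _ cp; rewrite mxE e => /(_ erefl) p0 px.
  have xN : x ord0 ord_max = 0 by lra.
  have cx : cube R n.+1 x by apply: slab_cube; rewrite // xN lexx ler01.
  by apply: (PhiC _ cx); rewrite cube_proj_id // in px; lra.
- have cx := slab_cube sx h.
  by rewrite cube_proj_id // subrr addr0 => /(PhiC _ cx).
- have := Phi1 _ cp; rewrite mxE e => /(_ erefl) p0 px.
  have xN : x ord0 ord_max = 1 by lra.
  have cx : cube R n.+1 x by apply: slab_cube; rewrite // xN lexx ler01.
  by apply: (PhiC _ cx); rewrite cube_proj_id // in px; lra.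
Qed.

Let slab_convex x y (t : R) : slab x -> slab y -> 0 <= t <= 1 ->
  slab (x + t *: (y - x)).
Proof.
move=> sx sy t01 i; rewrite !mxE; have := sx i; have := sy i.
by move: (x _ _) (y _ _) => u v; nra.
Qed.

(** At a bottom point [Phi] is only known to be nonpositive; pushing the point slightly below the
    cube makes [Phi_ext] negative. The top is symmetric. *)
Let minimal_cut_signs_ext x0 e : C x0 -> 0 < e ->
  (exists p, [/\ slab p, `|p - x0| < e & Phi_ext p < 0]) /\
  (exists q, [/\ slab q, `|q - x0| < e & 0 < Phi_ext q]).
Proof.
move=> Cx0 e0; have [_ Phi0 Phi1 _] := C_Phi.
pose push (p : V) (c : R) : V := \row_j if j == ord_max then p ord0 j + c else p ord0 j.
have push_lat p c i : push p c ord0 (lateral i) = p ord0 (lateral i).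
  by rewrite mxE -val_eqE /= (ltn_eqF (ltn_ord i)).
have push_last p c : push p c ord0 ord_max = p ord0 ord_max + c by rewrite mxE eqxx.
have push_dist p c : `|push p c - p| <= `|c|.
  apply: rV_norm_le => // j; rewrite !mxE; case: eqP => _.
    by rewrite addrAC subrr add0r.
  by rewrite subrr normr0.
have push_slab p c : cube R n.+1 p -> slab (push p c) by move=> cp i; rewrite push_lat.
have push_near p c : `|p - x0| < e -> `|c| <= (e - `|p - x0|) / 2 -> `|push p c - x0| < e.
  move=> pe ce; rewrite -(subrKA p); apply: le_lt_trans (ler_normD _ _) _.
  have := push_dist p c; lra.
have cubeS p : cube R n.+1 p -> slab p by move=> cp i; exact: cp.
have push_proj p c : cube R n.+1 p ->
    clamp01 (p ord0 ord_max + c) = p ord0 ord_max -> cube_proj (push p c) = p.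
  move=> cp h; apply/rowP; apply: last_or_lateral => [|i].
    by rewrite mxE push_last.
  by rewrite mxE push_lat clamp01_id.
have [[p [cp pe hp]] [q [cq qe hq]]] := minimal_cut_signs Cx0 e0; split.
  have [pneg|pN] := hp.
    exists p; split; [exact: cubeS | by [] |].
    by rewrite /Phi_ext cube_proj_id // clamp01_id // subrr addr0.
  pose c := - ((e - `|p - x0|) / 2); have c0 : c < 0 by rewrite /c; lra.
  have cl : clamp01 c = 0 by case: (clamp01P c) => -[h ->] //; lra.
  exists (push p c); split; first exact: push_slab.
    by apply: push_near => //; rewrite /c normrN ger0_norm //; lra.
  rewrite /Phi_ext push_proj // ?push_last pN add0r cl //.
  by have := Phi0 p cp pN; lra.
have [qpos|qN] := hq.
  exists q; split; [exact: cubeS | by [] |].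
  by rewrite /Phi_ext cube_proj_id // clamp01_id // subrr addr0.
pose c := (e - `|q - x0|) / 2; have c0 : 0 < c by rewrite /c; lra.
have cl : clamp01 (1 + c) = 1 by case: (clamp01P (1 + c)) => -[h ->] //; lra.
exists (push q c); split; first exact: push_slab.
  by apply: push_near => //; rewrite /c ger0_norm //; lra.
rewrite /Phi_ext push_proj // ?push_last qN cl //.
by have := Phi1 q cq qN; lra.
Qed.

(* A thin box around a segment joining points where [Phi_ext] has opposite
   signs lies near [x0] and is cut by [C]. *)
Lemma minimal_cut_local_dim (T : topologicalType) (rho : V -> T) (A : set T)
    x0 e k :
  hausdorff_space T -> {within cube R n.+1, continuous rho} ->
  {in cube R n.+1 &, injective rho} -> C x0 -> 0 < e ->
  (forall x, C x -> `|x - x0| < e -> A (rho x)) ->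
  covering_dim_lt (set_type A) k -> (n < k)%N.
Proof.
move=> hT crho injrho Cx0 e0 rhoA dimA.
have [[p [sp pe hp]] [q [sq qe hq]]] := minimal_cut_signs_ext Cx0 e0.
have [d1 /= d10 d1P] : exists2 d, 0 < d & forall y, `|y - p| < d -> Phi_ext y < 0.
  have np : 0 < - Phi_ext p by rewrite oppr_gt0.
  have /nbhs_ballP[d d0 dP] := Phi_ext_continuous (nbhsx_ballx (Phi_ext p) _ np).
  exists d => // y yp; have := dP y; rewrite -!ball_normE /= distrC => /(_ yp).
  by rewrite ltr_norml => /andP[h _]; lra.
have [d2 /= d20 d2P] : exists2 d, 0 < d & forall y, `|y - q| < d -> 0 < Phi_ext y.
  have /nbhs_ballP[d d0 dP] := Phi_ext_continuous (nbhsx_ballx (Phi_ext q) _ hq).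
  exists d => // y yp; have := dP y; rewrite -!ball_normE /= distrC => /(_ yp).
  by rewrite ltr_norml => /andP[_ h]; lra.
have [i pqi] : exists i, p ord0 i != q ord0 i.
  apply: contrapT => h; suff pq : p = q by move: hp; rewrite pq; lra.
  apply/rowP => i; apply/eqP; rewrite -[_ == _]negbK; apply/negP => ni.
  by apply: h; exists i.
(* The lateral coordinates of [x] fill the directions other than [i]. Direction [i] is frozen, so
   that the [i]-th coordinate of [L x] determines the position along the segment and [L] is
   injective. *)
pose v (x : V) : V := \row_j if unlift i j is Some l then x ord0 (lateral l) else 2^-1.
have v_lift x l : v x ord0 (lift i l) = x ord0 (lateral l) by rewrite mxE liftK.
have v_i x : v x ord0 i = 2^-1 by rewrite mxE unlift_none.
have vcube x : cube R n.+1 x -> cube R n.+1 (v x).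
  move=> cx j; case: (unliftP i j) => [l ->|->]; first by rewrite v_lift.
  by rewrite v_i; lra.
have [e1 [pe1 qe1 e1e]] : exists e1, [/\ `|p - x0| <= e1, `|q - x0| <= e1 & e1 < e].
  exists (Num.max `|p - x0| `|q - x0|).
  by rewrite !le_max !lexx orbT gt_max pe qe.
(* [M] bounds the distance from [v x] to the segment, so the box is within [eta * M] of it: below
   [d1] and [d2] for the signs at its ends, below [e - e1] to stay in the ball. *)
pose M := 1 + e.
have [eta [eta0 eta1 etad1 etad2 etae]] : exists eta : R,
    [/\ 0 < eta, eta < 1, eta * M < d1, eta * M < d2 & eta * M < e - e1].
  have M1 : 1 < M by rewrite /M; lra.
  pose m := Num.min 1 (Num.min (Num.min d1 d2) (e - e1)).
  have m0 : 0 < m by rewrite !lt_min ltr01 d10 d20 subr_gt0.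
  have M0 : 0 < M by lra.
  have mM : m / (2 * M) * M = m / 2 by field; lra.
  have m2 : m / 2 < m by lra.
  have : m <= m by [].
  rewrite {2}/m !le_min => /and3P[m1 /andP[md1 md2] me].
  exists (m / (2 * M)); rewrite mM; split; try lra.
    by rewrite divr_gt0 // mulr_gt0.
  by rewrite ltr_pdivrMr ?mulr_gt0 //; lra.
pose w (t : R) := p + t *: (q - p).
(* A convex combination, so that the box stays in the slab although [p] and [q] may be on its
   boundary. *)
pose L (x : V) := w (x ord0 ord_max) + eta *: (v x - w (x ord0 ord_max)).
have LE x j : L x ord0 j = (1 - eta) * (p ord0 j + x ord0 ord_max * (q ord0 j - p ord0 j))
    + eta * v x ord0 j by rewrite /L /w !mxE; ring.
have cv j : continuous (fun x => v x ord0 j).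
  case: (unliftP i j) => [l ->|->].
    by under eq_fun do rewrite v_lift; exact: coord_continuous.
  by under eq_fun do rewrite v_i; exact: cst_continuous.
have cL : continuous L.
  apply: rV_continuous => j; under eq_fun do rewrite LE.
  move=> x; apply: (@continuousD R R V (fun x =>
      (1 - eta) * (p ord0 j + x ord0 ord_max * (q ord0 j - p ord0 j)))).
    apply: (@continuousM R V (fun=> 1 - eta)); first exact: cst_continuous.
    apply: (@continuousD R R V (fun=> p ord0 j)); first exact: cst_continuous.
    apply: (@continuousM R V (fun x => x ord0 ord_max)); last exact: cst_continuous.
    exact: coord_continuous.
  apply: (@continuousM R V (fun=> eta)); first exact: cst_continuous.
  exact: cv.
have injL x y : L x = L y -> x = y.
  move=> /rowP Lxy.
  have xyN : x ord0 ord_max = y ord0 ord_max.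
    have := Lxy i; rewrite !LE !v_i => /addIr/mulfI.
    have -> : 1 - eta != 0 by rewrite gt_eqF // subr_gt0.
    move=> /(_ isT)/addrI/mulIf; apply.
    by rewrite subr_eq0 eq_sym.
  apply/rowP; apply: last_or_lateral => // l.
  have := Lxy (lift i l); rewrite !LE !v_lift xyN => /addrI/mulfI; apply.
  by rewrite gt_eqF.
have wslab t : 0 <= t <= 1 -> slab (w t) by move=> t01; exact: slab_convex.
have wnear t : 0 <= t <= 1 -> `|w t - x0| <= e1.
  move=> /andP[t0 t1].
  have -> : w t - x0 = (1 - t) *: (p - x0) + t *: (q - x0).
    by apply/rowP => j; rewrite /w !mxE; ring.
  apply: le_trans (ler_normD _ _) _; rewrite !normrZ !ger0_norm ?subr_ge0 //.
  apply: (@le_trans _ _ ((1 - t) * e1 + t * e1)); last by lra.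
  by rewrite lerD // ler_wpM2l // subr_ge0.
have vw x t : cube R n.+1 x -> 0 <= t <= 1 -> `|v x - w t| <= M.
  move=> cx t01; rewrite -(subrKA x0); apply: le_trans (ler_normD _ _) _.
  rewrite /M lerD //.
    apply: rV_norm_le => // j.
    have -> : (v x - x0) ord0 j = v x ord0 j - x0 ord0 j by rewrite mxE [X in _ + X]mxE.
    rewrite ler_norml.
    by have := vcube x cx j; have := C_cube Cx0 j; lra.
  by rewrite distrC (le_trans (wnear t t01)) // ltW.
have Lw x : cube R n.+1 x -> `|L x - w (x ord0 ord_max)| <= eta * M.
  move=> cx; rewrite /L addrAC subrr add0r normrZ gtr0_norm // ler_wpM2l ?(ltW eta0) //.
  by apply: vw => //; exact: cx.
have Lslab x : cube R n.+1 x -> slab (L x).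
  move=> cx; apply: slab_convex; first by apply: wslab; exact: cx.
    by move=> l; exact: vcube.
  by rewrite !ltW.
have Lnear x : cube R n.+1 x -> `|L x - x0| < e.
  move=> cx; rewrite -(subrKA (w (x ord0 ord_max))).
  apply: le_lt_trans (ler_normD _ _) _.
  have := Lw x cx; have := wnear _ (cx ord_max); lra.
pose E := cube R n.+1 `&` L @^-1` C.
have EC x : E x -> cube R n.+1 (L x) by move=> [_ /C_cube].
apply: (@separator_dim R n T E (Phi_ext \o L) (rho \o L) A k hT) => //.
- apply: closedI; first exact: cube_closed.
  exact: continuous_preimage_closed.
- by move=> x [].
- split.
  + exact: comp_continuous.
  + move=> x cx xN; apply/ltW/d1P; have := Lw x cx.
    by rewrite xN /w scale0r addr0 => h; exact: le_lt_trans h _.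
  + move=> x cx xN; apply/ltW/d2P; have := Lw x cx.
    by rewrite xN /w scale1r (addrC p) subrK => h; exact: le_lt_trans h _.
  + by move=> x cx /(Phi_ext_eq0 (Lslab x cx)) CL; split.
- apply: (within_comp (continuous_subspaceT cL) crho).
  by move=> _ [x Ex <-]; exact: EC.
- move=> x y; rewrite !inE => Ex Ey /= /injrho xy; apply/injL/xy; rewrite inE;
    exact: EC.
- by move=> _ [x [cx CLx] <-]; apply: rhoA => //; exact: Lnear.
Qed.

End local_dimension.

(** * Transport to the rectangle *)

Section rectangle.
Context {R : realType} {n : nat} {Z : metricType R} (X : oriented_rectangle n Z).
Notation V := 'rV[R]_n.+1.
Notation h := (rect_homeo X).

Lemma rect_inverse : {within cube R n.+1, continuous h} /\
  exists2 g : Z -> V, {within rect_carrier X, continuous g} &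
    forall x, cube R n.+1 x -> g (h x) = x.
Proof. by case: (rect_homeoP X). Qed.

Lemma rect_homeo_inj : {in cube R n.+1 &, injective h}.
Proof.
have [_ [g _ gK]] := rect_inverse.
by move=> x y; rewrite !inE => cx cy /(congr1 g); rewrite !gK.
Qed.

Lemma rect_image_closed (A : set V) : closed A -> A `<=` cube R n.+1 ->
  compact (h @` A) /\ closed (h @` A).
Proof.
move=> cA Acube; have [ch _] := rect_inverse.
have coA : compact (h @` A).
  apply: continuous_compact; first exact: continuous_subspaceW ch.
  by apply: subclosed_compact Acube => //; exact: cube_compact.
by split=> //; apply: compact_closed coA; exact: metric_hausdorff.
Qed.

Lemma lateral_faces_frontier (x : V) :
  cube R n.+1 x -> lateral_faces x -> frontier (cube R n.+1) x.
Proof.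
move=> cx [i xi]; split; first exact: subset_closure.
move=> /nbhs_ballP[e /= e0 eP].
(* Moving away from the centre of the cube leaves it through the face containing [x]. *)
pose y : V := x + (e / 2) *: (2 *: x - const_mx 1).
suff : cube R n.+1 y.
  move=> /(_ (lateral i)); rewrite !mxE.
  by case: xi => ->; lra.
apply: eP; rewrite -ball_normE /= /y opprD addrA subrr add0r normrN normrZ.
rewrite gtr0_norm ?divr_gt0 //; apply: (@le_lt_trans _ _ (e / 2 * 1)); last by lra.
rewrite ler_wpM2l ?divr_ge0 ?(ltW e0) //; apply: rV_norm_le => // j.
rewrite !mxE ler_norml.
by have := cx j; lra.
Qed.

Lemma centred_proj_continuous : continuous (@centred_proj R n).
Proof.
apply: rV_continuous => i; under eq_fun do rewrite mxE.
move=> x; apply: (@continuousB R R V (fun x => x ord0 (widen_ord (leqnSn n) i))).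
  exact: coord_continuous.
exact: cst_continuous.
Qed.

Lemma rect_cuts_arcs (C : set V) : closed C -> C `<=` cube R n.+1 ->
  cuts_cube C ->
  cuts_arcs R (rect_carrier X) (rect_left X) (rect_right X) (h @` C).
Proof.
move=> cC Ccube cutC; have [ch [g cg gK]] := rect_inverse.
have closed_last c : closed [set x : V | cube R n.+1 x /\ x ord0 ord_max = c].
  apply: closedI; first exact: cube_closed.
  exact: (continuous_preimage_closed
    (@coord_continuous R 1 n.+1 ord0 ord_max) (@closed_eq R c)).
have ne_last (c : R) : 0 <= c <= 1 ->
    h @` [set x : V | cube R n.+1 x /\ x ord0 ord_max = c] !=set0.
  move=> c01; exists (h (const_mx c)), (const_mx c) => //.
  by split=> [i|]; rewrite mxE.
split.
- by split=> _ [x xP <-]; exists x => //; [case: xP|case: xP|exact: Ccube].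
- by split; apply: (rect_image_closed _ _).2 => // x [].
- split; [apply: ne_last; lra | apply: ne_last; lra |].
  by have [x Cx] := cuts_cube_neq0 cutC; exists (h x), x.
- apply/seteqP; split=> // _ [[x [cx x0] <-] [y [cy y1] yx]].
  have e : y = x by apply: rect_homeo_inj; rewrite ?inE.
  by move: y1; rewrite e x0 => /eqP; rewrite eq_sym oner_eq0.
move=> p a b [ab cp] pX [_ [[s sab <-] [x [cx x0] xs]]] [_ [[t tab <-] [y [cy y1] yt]]].
have gp r : `[a, b]%classic r -> cube R n.+1 (g (p r)) /\ h (g (p r)) = p r.
  by move=> rab; have [|z cz zr] := pX (p r); [exists r | rewrite -zr gK].
have [|_ [r rab <-]||_ [[r rab <-] Cr]] := cutC (g \o p) a b.
- by split=> //; apply: (within_comp cp cg).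
- by have [] := gp r rab.
- split; [exists (g (p s)) | exists (g (p t))]; split.
  + by exists s.
  + by rewrite -xs gK.
  + by exists t.
  + by rewrite -yt gK.
- by exists (p r); split; [exists r | exists (g (p r)) => //; have [] := gp r rab].
Qed.

Lemma minimal_cut_dim_at_ge (C : set V) : closed C -> C `<=` cube R n.+1 ->
  cuts_cube C ->
  (forall C', C' `<=` C -> closed C' -> cuts_cube C' -> C' = C) ->
  forall z, (h @` C) z -> dim_at_ge (h @` C) z (n.+1%:Z - 1).
Proof.
move=> cC Ccube cutC Cmin _ [x Cx <-] U Ux k dimk.
have [Phi sepC] := cuts_separating cC Ccube cutC.
have [ch _] := rect_inverse.
have [e e0 eP] : exists2 e : R, 0 < e &
    forall y, cube R n.+1 y -> ball x e y -> U (h y).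
  move/subspace_continuousP : ch => /(_ x (Ccube _ Cx) _ Ux) /nbhs_ballP[e e0 eP].
  by exists e => // y cy xy; exact: eP.
suff : (n < k)%N by lia.
apply: (minimal_cut_local_dim cC Ccube Cmin sepC (metric_hausdorff (T := Z)) ch
  rect_homeo_inj Cx e0 _ dimk) => y Cy ye.
split; first by exists y.
by apply: eP; [exact: Ccube | rewrite -ball_normE /= distrC].
Qed.

Lemma cut_contour_dim_ge (C : set V) : closed C -> C `<=` cube R n.+1 ->
  cuts_cube C -> dim_ge (h @` C `&` rect_contour X) (n.+1%:Z - 2).
Proof.
move=> cC Ccube cutC k dimk.
have [Phi sepC] := cuts_separating cC Ccube cutC.
(* For N = 1 the bound is -1. *)
have [n0|n0] := posnP n; first by lia.
have [ch _] := rect_inverse.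
suff : (n <= k)%N by lia.
have LC : C `&` lateral_faces (n := n) `<=` cube R n.+1 by move=> x [/Ccube].
apply: (separator_lateral_dim n0 (metric_hausdorff (T := Z)) cC Ccube sepC _ _ _ dimk).
- exact: continuous_subspaceW ch.
- move=> x y; rewrite !inE => Lx Ly; apply: rect_homeo_inj; rewrite inE; exact: LC.
- move=> _ [x [Cx Lx] <-]; split; first by exists x.
  by exists x => //; apply: lateral_faces_frontier => //; exact: Ccube.
Qed.

(** The lateral part of [C] lies in the domain, and there the projection has the signs -1/2 and 1/2
    on opposite faces; a null-homotopy restricted to it would vanish somewhere or end at 0. *)
Lemma cut_centred_proj_essential (C : set V) : closed C -> C `<=` cube R n.+1 ->
  cuts_cube C ->
  essential R
    (centred_proj_domain (rect_preimage X (h @` C) `&` frontier (cube R n.+1)))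
    (~` [set (0 : 'rV[R]_n)]) (@centred_proj R n).
Proof.
move=> cC Ccube cutC; split.
- exact/continuous_subspaceT/centred_proj_continuous.
- by move=> _ [x [_ xP] <-].
move=> [c /= c0 [H [cH H_neq0 H0 H1]]].
have [Phi sepC] := cuts_separating cC Ccube cutC.
pose dom := centred_proj_domain (rect_preimage X (h @` C) `&` frontier (cube R n.+1)).
have projE (x : V) i : centred_proj x ord0 i = x ord0 (lateral i) - 2^-1 by rewrite mxE.
have Ldom : C `&` lateral_faces (n := n) `<=` dom.
  move=> x [Cx Lx]; have cx := Ccube _ Cx; split.
    split; first by split=> //; exists x.
    exact: lateral_faces_frontier.
  move: Lx => [i xi] /= /rowP /(_ i); rewrite projE mxE.
  by case: xi => ->; lra.
have [||||c_eq0|[x [t [Lx t01 Hx]]]] := @separator_homotopy_zero R n C Phi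
    (fun i xt => H xt ord0 i) (fun i => c ord0 i) cC Ccube sepC.
- move=> i; apply: (within_comp (B := setT) _
    (continuous_subspaceT (@coord_continuous R 1 n ord0 i))) => //.
  by apply: continuous_subspaceW cH => -[x t] [/= Lx t01]; split=> //; exact: Ldom.
- by move=> i x Lx; rewrite H1 //; exact: Ldom.
- by move=> i x Lx xi; rewrite H0 ?projE ?xi; [lra | exact: Ldom].
- by move=> i x Lx xi; rewrite H0 ?projE ?xi; [lra | exact: Ldom].
- by apply: c0; apply/rowP => i; rewrite c_eq0 mxE.
apply: (H_neq0 (H (x, t))).
  by exists (x, t) => //; split; [exact: Ldom | rewrite /= in_itv].
by apply/rowP => i; rewrite Hx mxE.
Qed.

(** * The map read in the cube *)

Section conjugate.
Context (Dpsi D K : set Z) (psi : Z -> Z) (g : Z -> V).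
Hypothesis g_cont : {within rect_carrier X, continuous g}.
Hypothesis gK : forall x, cube R n.+1 x -> g (h x) = x.

(** [g] inverts the homeomorphism only on the carrier, so points of [K] whose image leaves it are
    discarded; the sub-paths given by stretching have their images in the carrier and survive. *)
Definition conjugate_domain : set V :=
  [set x | cube R n.+1 x /\ K (h x)] `&` (psi \o h) @^-1` rect_carrier X.

Lemma conjugateE x : conjugate_domain x -> h (g (psi (h x))) = psi (h x).
Proof. by move=> [_ [y cy yx]]; rewrite -[psi _]yx gK. Qed.

Lemma conjugate_stretching : stretches_along_paths Dpsi psi D K X X ->
  stretching conjugate_domain (g \o psi \o h).
Proof.
move=> [DX KD coK cpsi s]; have [ch _] := rect_inverse.
have cK : closed K by apply: compact_closed coK; exact: metric_hausdorff.
pose A := [set x | cube R n.+1 x /\ K (h x)].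
have cA : closed A by apply: closed_within_preimage ch => //; exact: cube_closed.
have cpsih : {within A, continuous (psi \o h)}.
  apply: (within_comp (continuous_subspaceW _ ch) cpsi); first by move=> x [].
  by move=> _ [x [_ Kx] <-].
have X_closed : closed (rect_carrier X).
  by apply: (rect_image_closed _ _).2 => //; exact: cube_closed.
have gX z : rect_carrier X z -> cube R n.+1 (g z) by move=> [x cx <-]; rewrite gK.
split.
- exact: closed_within_preimage.
- by move=> x [[]].
- apply: (within_comp (f := psi \o h) (continuous_subspaceW _ cpsih) g_cont).
    by move=> x [].
  by move=> _ [x [_ Xx] <-].
- by move=> _ [x [_ Xx] <-]; exact: gX.
move=> p a b [ab cp] pcube [[_ [[u uab <-] [cu u0]]] [_ [[v vab <-] [cv v1]]]].
have [|||| c [d [[ac cd db] [pK ppX ppl ppr]]]] := s (h \o p) a b.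
- by split=> //; apply: (within_comp cp ch).
- by move=> _ [t tab <-]; exists (p t) => //; apply: pcube; exists t.
- by exists (h (p u)); split; [exists u | exists (p u)].
- by exists (h (p v)); split; [exists v | exists (p v)].
exists c, d; split=> //.
  move=> _ [t tcd <-]; split.
    split; last by apply: pK; exists t.
    apply: pcube; exists t => //; move: tcd; rewrite /= !in_itv /=; lra.
  by apply: ppX; exists (h (p t)) => //; exists t.
split.
  have [_ [[_ [t tcd <-] <-] [y [cy y0] yt]]] := ppl.
  exists y; split=> //; exists t => //=.
  by rewrite -[psi _]yt gK.
have [_ [[_ [t tcd <-] <-] [y [cy y0] yt]]] := ppr.
exists y; split=> //; exists t => //=.
by rewrite -[psi _]yt gK.
Qed.

End conjugate.
End rectangle.

Lemma periodic_mod (T : Type) (k : nat) (s : int -> T) (i : int) :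
  Defs.periodic k s -> s (i %% k)%Z = s i.
Proof.
move=> per; have perM (j : int) (q : nat) : s (j + (q * k)%:Z) = s j.
  elim: q => [|q IH]; first by rewrite mul0n addr0.
  by rewrite mulSn addnC PoszD addrA per.
have e := divz_eq i k; case: (i %/ k)%Z e => q e.
  by rewrite [in RHS]e addrC -PoszM perM.
rewrite -[RHS](perM _ q.+1); congr s.
by rewrite [in RHS]e NegzE PoszM; ring.
Qed.

Theorem theorem5p3 (R : realType) (n : nat) (Z : metricType R)
    (X : oriented_rectangle n Z) (Dpsi : set Z) (psi : Z -> Z)
    (D : set Z) (m : nat) (K : 'I_m -> set Z)
    (D_sub : D `<=` rect_carrier X `&` Dpsi)
    (m_ge2 : (2 <= m)%N)
    (K_sub : forall i, K i `<=` D)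
    (K_neq0 : forall i, K i !=set0)
    (K_compact : forall i, compact (K i))
    (K_disjoint : trivIset setT K)
    (K_stretch : forall i, stretches_along_paths Dpsi psi D (K i) X X) :
  induces_chaotic_dynamics Dpsi psi D K /\
  forall s : nat -> 'I_m, exists C : set Z,
    [/\ [/\ compact C, connected C & C `<=` K (s 0%N)],
        cuts_arcs R (rect_carrier X) (rect_left X) (rect_right X) C,
        forall w, C w -> exists y : nat -> Z,
          y 0%N = w /\ forall i, K (s i) (y i) /\ psi (y i) = y i.+1,
        forall z, C z -> dim_at_ge C z (n.+1%:Z - 1) &
        dim_ge (C `&` rect_contour X) (n.+1%:Z - 2) /\
        essential R
          (centred_proj_domain (rect_preimage X C `&` frontier (cube R n.+1)))
          (~` [set (0 : 'rV[R]_n)]) (@centred_proj R n)].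
Proof.
have [h_cont [g g_cont gK]] := rect_inverse X.
pose h := rect_homeo X; pose f := g \o psi \o h.
pose K' i := conjugate_domain X (K i) psi.
have K'_stretching i : stretching (K' i) f.
  exact: conjugate_stretching g_cont gK (K_stretch i).
have K'K i x : K' i x -> K i (h x) by move=> [[]].
have hf i x : K' i x -> h (f x) = psi (h x) by exact: conjugateE.
split.
  split=> //.
  - by split=> // z /D_sub[].
  - move=> s; have [w wP] := bi_infinite_itinerary K'_stretching s.
    exists (h \o w) => i; have [Kw wS] := wP i; have Kh := K'K _ _ Kw.
    split=> //; first exact: K_sub Kh.
    by rewrite /= wS (hf _ _ Kw).
  - move=> s k k0 per.
    have [x xP xk] := periodic_itinerary K'_stretching (fun j : nat => s j) k.
    (* Only forward iterates are available: negative times are reached by reading the closed orbit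
       modulo [k]. *)
    pose r (i : int) := absz (i %% k)%Z.
    have rE i : (r i)%:Z = (i %% k)%Z by rewrite gez0_abs // modz_ge0; lia.
    have rk i : (r i < k)%N by rewrite -ltz_nat rE ltz_pmod //; lia.
    exists (fun i => h (iter (r i) f x)).
      by move=> i; rewrite /r modzDr.
    move=> i; have Kr := xP _ (rk i).
    have es : s (r i) = s i by rewrite rE; exact: periodic_mod.
    rewrite -es; have Kh := K'K _ _ Kr; split=> //; first exact: K_sub Kh.
    rewrite -(hf _ _ Kr) -iterS; congr h.
    have rS : (r (i + 1))%:Z = ((r i).+1%:Z %% k)%Z.
      by rewrite rE -addn1 PoszD rE modzDml.
    have [rk'|rk'] := ltnP (r i).+1 k.
      by congr (iter _ _ _); apply/eqP; rewrite -eqz_nat rS modz_small.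
    have rik : (r i).+1 = k by have := rk i; lia.
    (* At the end of a period the orbit closes up because [iter k f] fixes [x]. *)
    rewrite rik xk; suff -> : r (i + 1) = 0%N by [].
    by apply/eqP; rewrite -eqz_nat rS rik modzz.
move=> s.
have [C [cC Citin cutC Cmin]] := minimal_cut
  (itinerary_closed K'_stretching (s := s)) (@itinerary_cuts _ _ _ _ _ K'_stretching s).
have Ccube : C `<=` cube R n.+1 by move=> x /Citin[].
exists (h @` C); split.
- split; first by have [] := rect_image_closed X cC Ccube.
  + apply: connected_continuous_connected; first exact: minimal_cut_connected.
    exact: continuous_subspaceW h_cont.
  + by move=> _ [x /Citin[_ xP] <-]; exact: K'K (xP 0%N).
- exact: rect_cuts_arcs.
- move=> _ [x /Citin[_ xP] <-]; exists (fun i => h (iter i f x)); split=> // i.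
  by have Kx := xP i; split; [exact: K'K | rewrite iterS (hf _ _ Kx)].
- exact: minimal_cut_dim_at_ge.
- by split; [exact: cut_contour_dim_ge | exact: cut_centred_proj_essential].
Qed.
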